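(* Let $(\Xi,m)$ be an abelian phase space with integrable irreducible projective representation $(U_x)_{x\in\Xi}$ on $\mathcal H$, let $S\subset\mathcal T^1(\mathcal H)$ be a regular subset and $H\subset\mathcal T^1(\mathcal H)$ relatively compact. If $X\subset\mathcal L(\mathcal H)$ is a bounded subset, $x\in\partial\Xi$ and $(x_\gamma)_{\gamma\in\Gamma}\subset\Xi$ is a net converging to $x$ such that for each $A_0\in S$ $$\sup_{B\in X}|A_0\ast[\alpha_{x_\gamma}(B)-\alpha_x(B)]|\overset{\gamma\in\Gamma}{\longrightarrow}0$$ uniformly on compact subsets of $\Xi$, then also $$\sup_{A\in H}\sup_{B\in X}|A\ast[\alpha_{x_\gamma}(B)-\alpha_x(B)]|\overset{\gamma\in\Gamma}{\longrightarrow}0$$ uniformly on compact subsets of $\Xi$ (the suprema being taken pointwise on $\Xi$).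
   Context: Phase space: $\Xi$ is a locally compact abelian group (additive, fixed Haar measure), $m:\Xi\times\Xi\to\mathbb T$ is separately continuous with $m(x+y,z)m(x,y)=m(x,y+z)m(y,z)$ and $m(x,y)=m(-x,-y)$, and, with $\sigma(x,y)=m(x,y)/m(y,x)$, the map $x\mapsto\sigma(x,\cdot)$ is a topological isomorphism $\Xi\to\widehat\Xi$. $(U_x)_{x\in\Xi}$ is the (unique up to unitary equivalence) irreducible strongly continuous unitary projective representation on a Hilbert space $\mathcal H$ with $U_xU_y=m(x,y)U_{x+y}$, and $R$ is a self-adjoint unitary on $\mathcal H$ (unique up to sign) with $RU_x=U_{-x}R$. Integrable means: there is $0\ne\varphi\in\mathcal H$ with $x\mapsto\langle U_x\varphi,\varphi\rangle\in L^1(\Xi)$. $\mathcal T^1(\mathcal H)$ denotes the trace class operators with trace norm. For operators $\alpha_x(A)=U_xAU_x^\ast$, $\beta_-(A)=RAR$. For $A\in\mathcal T^1(\mathcal H)$, $B\in\mathcal L(\mathcal H)$, $A\ast B$ is the function $A\ast B(y)=\operatorname{Tr}(A\,\alpha_y(\beta_-(B)))$ on $\Xi$. $\sigma\Xi$ is the maximal ideal space of the algebra of bounded uniformly continuous functions on $\Xi$, a compactification of $\Xi$ via point evaluations, $\partial\Xi=\sigma\Xi\setminus\Xi$. For $x\in\partial\Xi$ and $B\in\mathcal L(\mathcal H)\cong\mathcal T^1(\mathcal H)^\ast$, $\alpha_x(B)$ denotes the weak$^\ast$ limit of $\alpha_{y_\gamma}(B)$ for any net $\Xi\ni y_\gamma\to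 x$ in $\sigma\Xi$; it exists and is independent of the net. $S\subset\mathcal T^1(\mathcal H)$ is regular if $\operatorname{span}\{\alpha_x(A):A\in S,x\in\Xi\}$ is dense in $\mathcal T^1(\mathcal H)$ (equivalently, the functions $\xi\mapsto\operatorname{Tr}(AU_\xi)$, $A\in S$, have no common zero). *)

(* Defs.v *)
From HB Require Import structures.
From mathcomp Require Import all_boot all_order all_algebra.
From mathcomp Require Import complex.
From mathcomp Require Import all_classical all_reals all_analysis.

Set Implicit Arguments.
Unset Strict Implicit.
Unset Printing Implicit Defensive.

Import Order.TTheory GRing.Theory Num.Theory.
Import numFieldNormedType.Exports.

Local Open Scope classical_set_scope.
Local Open Scope ring_scope.

(* R[i] packed as a numClosedFieldType, so that the topology and norm that the
   library attaches to every numClosedFieldType are found by unification. *)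
Definition Cx (R : realType) : numClosedFieldType := R[i].

(* The norm of a numFieldType takes its values in the field itself, here in the
   nonnegative elements of Cx R; [cabs] is the same number read in R. *)
Definition cabs (R : realType) (z : Cx R) : R := complex.Re (`|z| : R[i]).

(** Hilbert spaces *)

HB.mixin Record NormedModule_isInnerProduct (R : realType) H
    & NormedModule (Cx R) H := {
  dot : H -> H -> Cx R ;
  dot_linearl : forall v : H, scalar (dot^~ v) ;
  dot_conj : forall u v : H, dot v u = (dot u v)^* ;
  dot_norm : forall u : H, dot u u = `|u| ^+ 2
}.

#[short(type="hilbertType")]
HB.structure Definition Hilbert (R : realType) :=
  {H of CompleteNormedModule (Cx R) H & NormedModule_isInnerProduct R H}.

(** Bounded operators *)

Definition is_bop (R : realType) (H : hilbertType R) : {pred H -> H} :=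
  [pred f : H -> H | `[< linear f /\ continuous f >]].
Arguments is_bop {R} H : simpl never.

Record bop (R : realType) (H : hilbertType R) :=
  Bop { bop_fun :> H -> H ; bopP : bop_fun \in is_bop H }.

HB.instance Definition _ (R : realType) (H : hilbertType R) :=
  [isSub for @bop_fun R H].
HB.instance Definition _ (R : realType) (H : hilbertType R) :=
  [Choice of bop H by <:].

Lemma is_bop_submod (R : realType) (H : hilbertType R) :
  submod_closed (is_bop H).
Proof.
split=> [|a f g /asboolP[fl fc] /asboolP[gl gc]]; apply/asboolP; split.
- by move=> k u v; rewrite scaler0 addr0.
- by move=> u; apply: cvg_cst.
- move=> k u v.
  have H1 w : (a *: f + g) w = a *: f w + g w by [].
  by rewrite !H1 fl gl !scalerDr !scalerA (mulrC a) addrACA.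
- move=> u; apply: cvgD; last exact: gc.
  by apply: cvgZr; exact: fc.
Qed.

HB.instance Definition _ (R : realType) (H : hilbertType R) :=
  GRing.isSubmodClosed.Build _ _ (is_bop H) (@is_bop_submod R H).
HB.instance Definition _ (R : realType) (H : hilbertType R) :=
  [SubChoice_isSubLmodule of bop H by <:].
HB.instance Definition _ (R : realType) (H : hilbertType R) :=
  isPointed.Build (bop H) 0.

Lemma comp_op_subproof (R : realType) (H : hilbertType R) (A B : bop H) :
  (A \o B : H -> H) \in is_bop H.
Proof.
have /asboolP[Al Ac] := bopP A; have /asboolP[Bl Bc] := bopP B.
apply/asboolP; split=> /=.
  by move=> k u v /=; rewrite Bl Al.
by move=> u; apply: continuous_comp; [exact: Bc | exact: Ac].
Qed.

Definition comp_op (R : realType) (H : hilbertType R) (A B : bop H) : bop H :=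
  Bop (comp_op_subproof A B).

(* Exists and is unique by the Riesz representation theorem; the default value
   of [xget] is never used. *)
Definition adjoint (R : realType) (H : hilbertType R) (A : bop H) : bop H :=
  xget 0 [set B : bop H | forall u v : H, dot (A u) v = dot u (B v)].

Definition unitary_op (R : realType) (H : hilbertType R) (A : bop H) : Prop :=
  cancel A (adjoint A) /\ cancel (adjoint A) A.

Definition self_adjoint (R : realType) (H : hilbertType R) (A : bop H) : Prop :=
  adjoint A = A.

Definition bounded_ops (R : realType) (H : hilbertType R) (X : set (bop H)) :=
  exists M : Cx R, forall B : bop H, X B -> forall u : H, `|B u| <= M * `|u|.

(** Trace class operators *)

Definition orthonormal_basis (R : realType) (H : hilbertType R) (E : set H) :=
  (forall e f : H, E e -> E f -> dot e f = (e == f)%:R) /\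
  (forall u : H, (forall e : H, E e -> dot u e = 0) -> u = 0).

(* One fixed orthonormal basis. The trace norm of any operator and the trace of
   a trace class operator do not depend on its choice. *)
Definition onb (R : realType) (H : hilbertType R) : set H :=
  xget set0 [set E : set H | orthonormal_basis E].
Arguments onb {R} H.

Definition positive_op (R : realType) (H : hilbertType R) (P : bop H) : Prop :=
  forall u : H, 0 <= dot (P u) u.

(* |A| = (A^* A)^(1/2), the unique positive square root. *)
Definition abs_op (R : realType) (H : hilbertType R) (A : bop H) : bop H :=
  xget 0 [set P : bop H |
    positive_op P /\ comp_op P P = comp_op (adjoint A) A].

Definition trace_norm (R : realType) (H : hilbertType R) (A : bop H) : \bar R :=
  \esum_(e in onb H) (complex.Re (dot (abs_op A e) e : R[i]))%:E.

Record trace_class (R : realType) (H : hilbertType R) := TraceClass {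
  trace_class_op :> bop H ;
  trace_classP : `[< (trace_norm trace_class_op < +oo)%E >] }.

HB.instance Definition _ (R : realType) (H : hilbertType R) :=
  [isSub for @trace_class_op R H].
HB.instance Definition _ (R : realType) (H : hilbertType R) :=
  [Choice of trace_class H by <:].

Definition trace_norm_ball (R : realType) (H : hilbertType R)
    (Ar : bop H * R) : set (trace_class H) :=
  [set B : trace_class H | (trace_norm (Ar.1 - trace_class_op B)%R < Ar.2%:E)%E].

(* The topology generated by the open balls with trace class centres, that is,
   the topology of the trace norm. *)
HB.instance Definition _ (R : realType) (H : hilbertType R) :=
  @isSubBaseTopological.Build (trace_class H)
    (bop H * R)%type
    [set Ar | (trace_norm Ar.1 < +oo)%E /\ 0 < Ar.2]
    (@trace_norm_ball R H).

Definition finite_subsets (T : Type) (E : set T) : set_system (set T) :=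
  filter_from [set F : set T | finite_set F /\ F `<=` E]
    (fun F => [set G : set T | [/\ finite_set G, F `<=` G & G `<=` E]]).

Definition trace (R : realType) (H : hilbertType R) (A : bop H) : Cx R :=
  lim ((fun F : set H => \sum_(e \in F) dot (A e) e) @ finite_subsets (onb H)).

(** Phase spaces and projective representations *)

Section PhaseSpace.
Variables (R : realType) (Xi : topologicalZmodType).

Definition unimodular_character (chi : Xi -> Cx R) : Prop :=
  [/\ continuous chi,
      forall x, `|chi x| = 1 &
      forall x y, chi (x + y) = chi x * chi y].

(* The Pontryagin dual, with the compact-open topology. *)
Definition dual_carrier : Type :=
  {chi : {compact-open, Xi -> Cx R} | `[< unimodular_character chi >]}.

Definition dual_group : topologicalType :=
  initial_topology (sval : dual_carrier -> {compact-open, Xi -> Cx R}).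

Definition sigma_of (m : Xi -> Xi -> Cx R) (x y : Xi) : Cx R := m x y / m y x.

Definition sigma_isomorphism (m : Xi -> Xi -> Cx R) : Prop :=
  (forall x z y, sigma_of m (x + z) y = sigma_of m x y * sigma_of m z y) /\
  exists (f : Xi -> dual_group) (g : dual_group -> Xi),
    [/\ forall x y, sval (f x) y = sigma_of m x y,
        cancel f g, cancel g f, continuous f & continuous g].

Record phase_space (m : Xi -> Xi -> Cx R) : Prop := {
  phase_hausdorff : hausdorff_space Xi ;
  phase_locally_compact : locally_compact [set: Xi] ;
  phase_unimodular : forall x y, `|m x y| = 1 ;
  phase_continuousl : forall y, continuous (m^~ y) ;
  phase_continuousr : forall x, continuous (m x) ;
  phase_cocycle : forall x y z,
    m (x + y) z * m x y = m x (y + z) * m y z ;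
  phase_even : forall x y, m x y = m (- x) (- y) ;
  phase_sigma : sigma_isomorphism m }.

(* The carrier is written as that of the underlying zmodType because the library
   makes that one pointed (by 0), as measurable types must be. *)
Definition borel : measurableType (@open Xi).-sigma :=
  [the measurableType _ of
     @g_sigma_algebraType (GRing.Zmodule.sort Xi) (@open Xi)].

Record haar_measure
    (mu : {measure set borel -> \bar R}) : Prop := {
  haar_invariant : forall (x : Xi) (A : set Xi), measurable (A : set borel) ->
    mu [set x + a | a in A] = mu A ;
  haar_open : forall A : set Xi, open A -> A !=set0 -> (0 < mu A)%E ;
  haar_compact : forall A : set Xi, compact A -> (mu A < +oo)%E ;
  haar_outer : forall A : set Xi, measurable (A : set borel) ->
    mu A = ereal_inf [set mu V | V in [set V | open V /\ A `<=` V]] ;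
  haar_inner : forall A : set Xi, open A ->
    mu A = ereal_sup [set mu K | K in [set K | compact K /\ K `<=` A]] }.

Variable H : hilbertType R.

Record projective_rep (m : Xi -> Xi -> Cx R) (U : Xi -> bop H) : Prop := {
  rep_unitary : forall x, unitary_op (U x) ;
  rep_strongly_continuous : forall v : H, continuous (fun x => U x v) ;
  rep_mul : forall x y, comp_op (U x) (U y) = m x y *: U (x + y) }.

Definition irreducible_rep (U : Xi -> bop H) : Prop :=
  (exists v : H, v <> 0) /\
  forall V : set H,
    closed V -> V 0 ->
    (forall (a : Cx R) (u v : H), V u -> V v -> V (a *: u + v)) ->
    (forall (x : Xi) (v : H), V v -> V (U x v)) ->
    V = [set 0] \/ V = [set: H].

Definition integrable_rep
    (mu : {measure set borel -> \bar R})
    (U : Xi -> bop H) : Prop :=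
  exists phi : H, phi <> 0 /\
    mu.-integrable [set: borel]
      (fun x => (complex.Re (dot (U x phi) phi : R[i]))%:E) /\
    mu.-integrable [set: borel]
      (fun x => (complex.Im (dot (U x phi) phi : R[i]))%:E).

Definition parity_op (U : Xi -> bop H) (P : bop H) : Prop :=
  [/\ self_adjoint P, unitary_op P &
      forall x, comp_op P (U x) = comp_op (U (- x)) P].

Definition alpha (U : Xi -> bop H) (x : Xi) (A : bop H) : bop H :=
  comp_op (comp_op (U x) A) (adjoint (U x)).

Definition beta_minus (P : bop H) (A : bop H) : bop H :=
  comp_op (comp_op P A) P.

Definition conv (U : Xi -> bop H) (P : bop H) (A B : bop H) (y : Xi) : Cx R :=
  trace (comp_op A (alpha U y (beta_minus P B))).

Definition lin_span (V : lmodType (Cx R)) (S : set V) : set V :=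
  [set v | exists (n : nat) (c : 'I_n -> Cx R) (a : 'I_n -> V),
    (forall i, S (a i)) /\ v = \sum_(i < n) c i *: a i].

Definition regular_set (U : Xi -> bop H) (S : set (trace_class H)) : Prop :=
  dense [set A : trace_class H | lin_span
    [set B : bop H | exists (A0 : trace_class H) (x : Xi),
       S A0 /\ B = alpha U x A0] A].

End PhaseSpace.

(** The compactification *)

Section Compactification.
Variables (R : realType) (Xi : topologicalZmodType).

Definition is_buc : {pred Xi -> Cx R} :=
  [pred f : Xi -> Cx R | `[<
    (exists M : Cx R, forall x, `|f x| <= M) /\
    (forall e : Cx R, 0 < e ->
      \forall v \near (0 : Xi), forall x, `|f (x + v) - f x| < e) >]].

Record buc := Buc { buc_fun :> Xi -> Cx R ; bucP : buc_fun \in is_buc }.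

HB.instance Definition _ := [isSub for buc_fun].
HB.instance Definition _ := [Choice of buc by <:].

Lemma is_buc_submod : submod_closed is_buc.
Proof.
split=> [|a f g /asboolP[[M fM] fu] /asboolP[[N gN] gu]]; apply/asboolP; split.
- by exists 0 => x; rewrite normr0.
- by move=> e e0; near=> v => x; rewrite subrr normr0.
- exists (`|a| * M + N) => x; apply: (le_trans (ler_normD _ _)).
  by apply: lerD; [rewrite normrM ler_wpM2l | exact: gN].
- move=> e e0.
  have a0 : 0 < `|a| + 1 by rewrite ltr_wpDl.
  have h0 : 0 < e / 2 by rewrite divr_gt0.
  have k0 : 0 < e / 2 / (`|a| + 1) by rewrite divr_gt0.
  near=> v => x.
  have fx : `|f (x + v) - f x| < e / 2 / (`|a| + 1).
    by move: x; near: v; exact: fu.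
  have gx : `|g (x + v) - g x| < e / 2 by move: x {fx}; near: v; exact: gu.
  rewrite [X in `|X|](_ : _ =
    a * (f (x + v) - f x) + (g (x + v) - g x)); last first.
    by rewrite mulrBr addrACA -opprD.
  rewrite (le_lt_trans (ler_normD _ _))// [ltRHS]splitr ler_ltD//.
  rewrite normrM (@le_trans _ _ ((`|a| + 1) * `|f (x + v) - f x|))//.
    by rewrite ler_wpM2r// lerDl.
  by rewrite mulrC -ler_pdivlMr// ltW.
Unshelve. all: by end_near.
Qed.

Lemma is_buc_subring : subring_closed is_buc.
Proof.
split.
- apply/asboolP; split; first by exists 1 => x; rewrite normr1.
  by move=> e e0; near=> v => x; rewrite subrr normr0.
- move=> f g fb gb; rewrite -[X in _ + X](scaleN1r g) addrC.
  by apply: is_buc_submod.2.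
- move=> f g /asboolP[[M fM] fu] /asboolP[[N gN] gu]; apply/asboolP; split.
    by exists (M * N) => x; rewrite normrM ler_pM.
  have M0 : 0 <= M by exact: le_trans (fM 0).
  have N0 : 0 <= N by exact: le_trans (gN 0).
  move=> e e0.
  have a0 : 0 < M + 1 by rewrite ltr_wpDl.
  have b0 : 0 < N + 1 by rewrite ltr_wpDl.
  have h0 : 0 < e / 2 / (N + 1) by rewrite !divr_gt0.
  have k0 : 0 < e / 2 / (M + 1) by rewrite !divr_gt0.
  near=> v => x.
  have fx : `|f (x + v) - f x| < e / 2 / (N + 1).
    by move: x; near: v; exact: fu.
  have gx : `|g (x + v) - g x| < e / 2 / (M + 1).
    by move: x {fx}; near: v; exact: gu.
  rewrite [X in `|X|](_ : _ =
    f (x + v) * (g (x + v) - g x) + (f (x + v) - f x) * g x); last first.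
    by rewrite mulrBr mulrBl addrA subrK.
  rewrite (le_lt_trans (ler_normD _ _))// [ltRHS]splitr ler_ltD//.
    rewrite normrM -[leRHS](divfK (lt0r_neq0 a0)) mulrC.
    apply: ler_pM => //; first exact: ltW.
    by rewrite (le_trans (fM _))// lerDl.
  rewrite normrM -[ltRHS](divfK (lt0r_neq0 b0)).
  rewrite (@le_lt_trans _ _ (`|f (x + v) - f x| * (N + 1)))//.
    by rewrite ler_wpM2l// (le_trans (gN _))// lerDl.
  by rewrite ltr_pM2r.
Unshelve. all: by end_near.
Qed.

HB.instance Definition _ :=
  GRing.isSubringClosed.Build _ is_buc is_buc_subring.
HB.instance Definition _ :=
  GRing.isSubmodClosed.Build _ _ is_buc is_buc_submod.
HB.instance Definition _ :=
  GRing.SubChoice_isSubPzRing.Build _ _ buc is_buc_subring.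
HB.instance Definition _ := [SubZmodule_isSubLmodule of buc by <:].

(* The maximal ideal space as the set of unital algebra homomorphisms to the
   complex numbers, with the topology of pointwise convergence. *)
Definition gelfand_character (chi : buc -> Cx R) : Prop :=
  scalar chi /\ monoid_morphism chi.

Definition sigma_carrier : Type :=
  {chi : {ptws buc -> Cx R} | `[< gelfand_character chi >]}.

Definition sigmaXi : topologicalType :=
  initial_topology (sval : sigma_carrier -> {ptws buc -> Cx R}).

Lemma point_eval_subproof (x : Xi) :
  `[< gelfand_character (fun f : buc => f x) >].
Proof. by apply/asboolP; split; [move=> a f g | split=> // f g]. Qed.

Definition point_eval (x : Xi) : sigmaXi :=
  exist _ (fun f : buc => f x) (point_eval_subproof x).

Definition boundary : set sigmaXi := ~` range point_eval.

(* The extension of [alpha] to the boundary. Nets in Xi converging to x are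
   replaced by proper filters converging to x; the weak^* convergence is tested
   against all trace class operators. The limit exists and is unique. *)
Definition alpha_bd (H : hilbertType R) (U : Xi -> bop H) (x : sigmaXi)
    (B : bop H) : bop H :=
  xget 0 [set C : bop H | forall F : set_system Xi, ProperFilter F ->
    point_eval @ F --> x ->
    forall A : trace_class H,
      (fun y => trace (comp_op A (alpha U y B))) @ F --> trace (comp_op A C)].

End Compactification.

(** Nets and uniform convergence *)

Definition directed (T : Type) (le : T -> T -> Prop) : Prop :=
  [/\ inhabited T,
      forall a, le a a,
      forall a b c, le a b -> le b c -> le a c &
      forall a b, exists c, le a c /\ le b c].

Definition tails (T : Type) (le : T -> T -> Prop) : set_system T :=
  filter_from [set: T] (fun a => [set b | le a b]).

(* y |-> sup_{B in X} |A * [alpha_z(B) - alpha_x(B)]|(y). The library's [sup] is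
   real-valued, with [sup set0 = 0]; it is a genuine supremum here because for
   bounded X the values are bounded by a multiple of the trace norm of A. *)
Definition sup_defect (R : realType) (Xi : topologicalZmodType)
    (H : hilbertType R) (U : Xi -> bop H) (P : bop H) (X : set (bop H))
    (x : sigmaXi R Xi) (z : Xi) (A : trace_class H) (y : Xi) : R :=
  sup [set cabs (conv U P A (alpha U z B - alpha_bd U x B) y) | B in X].

(* Main.v *)
Require Import Defs.
From HB Require Import structures.
From mathcomp Require Import all_boot all_order all_algebra.
From mathcomp Require Import complex ring lra.
From mathcomp Require Import all_classical all_reals all_analysis.

Set Implicit Arguments.
Unset Strict Implicit.
Unset Printing Implicit Defensive.

Import Order.TTheory GRing.Theory Num.Theory.
Import numFieldNormedType.Exports.

Local Open Scope classical_set_scope.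
Local Open Scope ring_scope.

(* On the rank-one operators the functional defining alpha_x(B) shows that
   alpha_x inherits the norm bound M of X, so the defects
   D = alpha_{x_gamma}(B) - alpha_x(B) are bounded by 2 M, uniformly in B and
   gamma.  The inequality |Tr(A D)| <= C(|D|) |A|_1 then makes A |-> A * D
   equicontinuous in the trace norm, uniformly in D and on Xi.  The set of A for
   which sup_B |A * D| tends to 0 uniformly on compact sets is a linear space
   that contains S and is stable under every alpha_w, because
   alpha_w(A) * D (y) = A * D (y - w): the phases of the cocycle cancel.  By
   regularity it is dense, and by equicontinuity every A in the compact closure
   of K has a trace norm neighbourhood on which the defects are eventually small.

   The trace is handled by writing A = W Q with W and Q Hilbert-Schmidt and
   |W|_2^2 = |Q|_2^2 = |A|_1: take Q = |A|^(1/2), and for W the strong limit of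
   A t sum_{k < n} (1 - t Q)^k for a small t > 0. *)

(** * Real and complex numbers *)

Section ComplexReal.
Variable R : realType.
Implicit Types (z w : Cx R) (a : R).

Definition re z : R := complex.Re (z : R[i]).
Definition im z : R := complex.Im (z : R[i]).
Definition ic : Cx R := Complex 0 1.
Definition rc a : Cx R := real_complex R a.

Lemma reD z w : re (z + w) = re z + re w.
Proof. by case: z w => [? ?] [? ?]. Qed.

Lemma reN z : re (- z) = - re z.
Proof. by case: z. Qed.

Lemma re_conj z : re z^* = re z.
Proof. by case: z. Qed.

Lemma re_rcM a z : re (rc a * z) = a * re z.
Proof. by case: z => x y; rewrite /re /rc /= mul0r subr0. Qed.

Lemma re_rc a : re (rc a) = a. Proof. by []. Qed.

Lemma cplxE z : z = rc (re z) + ic * rc (im z).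
Proof. exact: complexE. Qed.

Lemma normr_cabs z : `|z| = rc (cabs z).
Proof. by rewrite /cabs normc_def. Qed.

Lemma rcD a b : rc (a + b) = rc a + rc b.
Proof. by rewrite /rc rmorphD. Qed.
Lemma rcM a b : rc (a * b) = rc a * rc b.
Proof. by rewrite /rc rmorphM. Qed.
Lemma rcB a b : rc (a - b) = rc a - rc b.
Proof. by rewrite /rc rmorphB. Qed.
Lemma rcX a n : rc (a ^+ n) = rc a ^+ n.
Proof. by rewrite /rc rmorphXn. Qed.
Lemma rc_inj : injective rc. Proof. by move=> a b []. Qed.
Lemma ler_rc a b : (rc a <= rc b) = (a <= b).
Proof. exact: lecR. Qed.
Lemma rc_ge0 a : (0 <= rc a) = (0 <= a).
Proof. exact: ler0c. Qed.
Lemma ltr_rc a b : (rc a < rc b) = (a < b).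
Proof. exact: ltcR. Qed.

Lemma cplx_gt0 z : 0 < z -> z = rc (re z) /\ 0 < re z.
Proof.
by case: z => x y; rewrite ltcE /= => /andP[/eqP -> ?].
Qed.
Lemma cplx_ge0 z : 0 <= z -> z = rc (re z) /\ 0 <= re z.
Proof.
by case: z => x y; rewrite lecE /= => /andP[/eqP -> ?].
Qed.

Lemma cabs_ge0 z : 0 <= cabs z.
Proof. by rewrite -ler_rc -normr_cabs normr_ge0. Qed.
Lemma cabsM z w : cabs (z * w) = cabs z * cabs w.
Proof. by apply: rc_inj; rewrite rcM -!normr_cabs normrM. Qed.
Lemma cabsD z w : cabs (z + w) <= cabs z + cabs w.
Proof. by rewrite -ler_rc rcD -!normr_cabs ler_normD. Qed.
Lemma cabs_rc a : cabs (rc a) = `|a|.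
Proof.
by rewrite /cabs normc_def /= expr0n /= addr0 sqrtr_sqr.
Qed.
Lemma cabs_sqr z : cabs z ^+ 2 = re z ^+ 2 + im z ^+ 2.
Proof. by rewrite /cabs normc_def /= sqr_sqrtr// addr_ge0 ?sqr_ge0. Qed.
Lemma cabs_conj z : cabs z^* = cabs z.
Proof. by apply: rc_inj; rewrite -!normr_cabs norm_conjC. Qed.
Lemma cabsN z : cabs (- z) = cabs z.
Proof. by apply: rc_inj; rewrite -!normr_cabs normrN. Qed.
(** Three-epsilon step [v = w + (z - w) - (z - v)]: in the final estimate [z] is the value at the
    centre of a ball, [w] and [v] are the values at two points of that ball. *)
Lemma cabs_near z w v a b c : cabs (z - w) <= a -> cabs (z - v) <= b ->
  cabs w <= c -> cabs v <= a + b + c.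
Proof.
move=> h1 h2 h3; have vE : v = w + ((z - w) - (z - v)) by ring.
have := cabsD w ((z - w) - (z - v)); rewrite -vE.
by have := cabsD (z - w) (- (z - v)); rewrite cabsN; lra.
Qed.
Lemma re_le_cabs z : re z <= cabs z.
Proof.
apply: le_trans (ler_norm _) _; rewrite -(@ler_pXn2r _ 2) ?nnegrE ?cabs_ge0//.
by rewrite cabs_sqr real_normK ?num_real// lerDl sqr_ge0.
Qed.
End ComplexReal.

(** * Inner product *)

Section InnerProduct.
Variables (R : realType) (H : hilbertType R).
Implicit Types (u v w : H) (a : Cx R) (s : R).

(* The library's norm on [H] is [Cx R]-valued; [hn] is the same number in [R]. *)
Definition hn u : R := re (`|u|).
Definition rd u v : R := re (dot u v).

Lemma dotDl u v w : dot (u + v) w = dot u w + dot v w.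
Proof. by have := dot_linearl w 1 u v; rewrite /= scale1r mul1r. Qed.

Lemma dot0l w : dot 0 w = 0.
Proof. by apply: (addrI (dot 0 w)); rewrite -dotDl !addr0. Qed.

Lemma dotZl a u w : dot (a *: u) w = a * dot u w.
Proof. by have := dot_linearl w a u 0; rewrite /= !addr0 dot0l addr0. Qed.

Lemma dotDr u v w : dot w (u + v) = dot w u + dot w v.
Proof. by rewrite dot_conj dotDl rmorphD /= -!dot_conj. Qed.

Lemma dotZr a u w : dot w (a *: u) = a^* * dot w u.
Proof. by rewrite dot_conj dotZl rmorphM /= -dot_conj. Qed.

Lemma dot0r w : dot w 0 = 0.
Proof. by rewrite dot_conj dot0l rmorph0. Qed.

Lemma dotNl u w : dot (- u) w = - dot u w.
Proof. by rewrite -scaleN1r dotZl mulN1r. Qed.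

Lemma dotBl u v w : dot (u - v) w = dot u w - dot v w.
Proof. by rewrite dotDl dotNl. Qed.

Lemma dot_suml (I : Type) (r : seq I) (f : I -> H) w :
  dot (\sum_(i <- r) f i) w = \sum_(i <- r) dot (f i) w.
Proof. by elim/big_rec2: _ => [|i x y _ <-]; rewrite ?dot0l ?dotDl. Qed.

Lemma hnormE u : `|u| = rc (hn u).
Proof. by have [] := cplx_ge0 (normr_ge0 u). Qed.

Lemma hn_ge0 u : 0 <= hn u.
Proof. by have [] := cplx_ge0 (normr_ge0 u). Qed.

Lemma hn0 : hn 0 = 0. Proof. by rewrite /hn normr0. Qed.

Lemma hn_eq0 u : hn u = 0 -> u = 0.
Proof. by move=> u0; apply: normr0_eq0; rewrite hnormE u0. Qed.

Lemma hnD u v : hn (u + v) <= hn u + hn v.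
Proof. by rewrite -ler_rc rcD -!hnormE ler_normD. Qed.

Lemma hnN u : hn (- u) = hn u.
Proof. by rewrite /hn normrN. Qed.

Lemma hn_distC u v : hn (u - v) = hn (v - u).
Proof. by rewrite -hnN opprB. Qed.

Lemma hn_tri w u v : hn (u - v) <= hn (u - w) + hn (w - v).
Proof. by rewrite (le_trans _ (hnD _ _))// addrA subrK. Qed.

Lemma hnZ a u : hn (a *: u) = cabs a * hn u.
Proof. by apply: rc_inj; rewrite rcM -hnormE -normr_cabs -hnormE normrZ. Qed.

Lemma rdD u v w : rd (u + v) w = rd u w + rd v w.
Proof. by rewrite /rd dotDl reD. Qed.
Lemma rdC u v : rd u v = rd v u.
Proof. by rewrite /rd dot_conj re_conj. Qed.
Lemma rdZ s u w : rd (rc s *: u) w = s * rd u w.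
Proof. by rewrite /rd dotZl re_rcM. Qed.
Lemma rdN u w : rd (- u) w = - rd u w.
Proof. by rewrite /rd dotNl reN. Qed.
Lemma rdDr u v w : rd w (u + v) = rd w u + rd w v.
Proof. by rewrite !(rdC w) rdD. Qed.
Lemma rdZr s u w : rd w (rc s *: u) = s * rd w u.
Proof. by rewrite !(rdC w) rdZ. Qed.
Lemma rdNr u w : rd w (- u) = - rd w u.
Proof. by rewrite !(rdC w) rdN. Qed.
Lemma rd0 w : rd 0 w = 0. Proof. by rewrite /rd dot0l. Qed.

Definition rdE := (rdD, rdDr, rdZ, rdZr, rdN, rdNr).

Lemma rd_hn u : rd u u = hn u ^+ 2.
Proof.
by rewrite /rd dot_norm hnormE -rcX re_rc.
Qed.

Lemma im_dot u v : im (dot u v) = rd u (ic R *: v).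
Proof.
by rewrite /rd dotZr; case: (dot u v) => x y; rewrite /im /re /= mul0r mulN1r sub0r opprK.
Qed.

(** The real form [rd] determines the complex inner product, so much of what follows runs over the
    reals; [ic R *: v] picks out the imaginary part because the second slot is conjugate linear. *)
Lemma dotE u v : dot u v = rc (rd u v) + ic R * rc (rd u (ic R *: v)).
Proof. by rewrite -im_dot -cplxE. Qed.

Lemma rd_inj u v : (forall w, rd u w = rd v w) -> u = v.
Proof.
move=> uv; apply/eqP; rewrite -subr_eq0; apply/eqP/hn_eq0.
apply/eqP; rewrite -sqrf_eq0 -rd_hn; apply/eqP.
by rewrite rdD rdN uv subrr.
Qed.

(** The squared norm of |v| u - |u| v is nonnegative and equals 2 |u| |v| (|u| |v| - Re <u, v>). *)
Lemma cauchy_schwarz u v : rd u v <= hn u * hn v.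
Proof.
have [u0|u0] := eqVneq (hn u) 0.
  by rewrite (hn_eq0 u0) rd0 hn0 mul0r.
have [v0|v0] := eqVneq (hn v) 0.
  by rewrite (hn_eq0 v0) rdC rd0 hn0 mulr0.
have up : 0 < hn u by rewrite lt_neqAle eq_sym u0 hn_ge0.
have vp : 0 < hn v by rewrite lt_neqAle eq_sym v0 hn_ge0.
have : 0 <= rd (rc (hn v) *: u - rc (hn u) *: v) (rc (hn v) *: u - rc (hn u) *: v).
  by rewrite rd_hn sqr_ge0.
rewrite !rdE !rd_hn (rdC v u) => h.
have : 0 <= (2 * hn u * hn v) * (hn u * hn v - rd u v).
  by apply: le_trans h _; rewrite le_eqVlt; apply/orP; left; apply/eqP; ring.
by rewrite pmulr_rge0 ?subr_ge0// !mulr_gt0.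
Qed.

(** Rotating [u] by the conjugate of [d] makes the inner product the real number |d|^2; the real
    inequality is then divided by |d|. *)
Lemma cauchy_schwarzC u v : cabs (dot u v) <= hn u * hn v.
Proof.
set d := dot u v.
have [d0|d0] := eqVneq (cabs d) 0; first by rewrite d0 mulr_ge0 ?hn_ge0.
have dp : 0 < cabs d by rewrite lt_neqAle eq_sym d0 cabs_ge0.
have := cauchy_schwarz (d^* *: u) v.
have -> : rd (d^* *: u) v = cabs d ^+ 2.
  by rewrite /rd dotZl -/d cabs_sqr; case: (d) => x y; rewrite /re /im /=; ring.
have -> : hn (d^* *: u) = cabs d * hn u.
  by rewrite hnZ; congr (_ * _); apply: rc_inj; rewrite -!normr_cabs norm_conjC.
by rewrite expr2 -mulrA ler_pM2l.
Qed.

Lemma cvg_hnP (I : Type) (F : set_system I) {FF : Filter F} (f : I -> H) l :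
  f @ F --> l <-> forall e : R, 0 < e -> \forall i \near F, hn (l - f i) < e.
Proof.
split=> [/cvgrPdist_lt fl e e0|fl].
  have : 0 < rc e by rewrite -[0]/(rc 0) ltr_rc.
  by move/fl; apply: filterS => i; rewrite hnormE ltr_rc.
apply/cvgrPdist_lt => e /cplx_gt0[eE e0]; rewrite eE.
by have := fl _ e0; apply: filterS => i; rewrite hnormE ltr_rc.
Qed.

Lemma cauchy_hn_cvg (I : Type) (F : set_system I) {FF : ProperFilter F}
    (f : I -> H) :
  (forall e : R, 0 < e -> exists2 A, F A & forall i j, A i -> A j -> hn (f i - f j) < e) ->
  cvg (f @ F).
Proof.
move=> fC; apply/cauchy_cvgP; apply: cauchy_exP => e /cplx_gt0[eE e0]; rewrite eE.
have [A FA fA] := fC _ e0.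
have [i Ai] := filter_ex FA.
exists (f i); apply: (@filterS _ F _ A) FA => j Aj.
by rewrite -ball_normE /= hnormE ltr_rc; exact: fA.
Qed.

Lemma cplx_cvgP (I : Type) (F : set_system I) {FF : Filter F} (f : I -> Cx R) l :
  f @ F --> l <-> forall e : R, 0 < e -> \forall i \near F, cabs (l - f i) < e.
Proof.
split=> [/cvgrPdist_lt fl e e0|fl].
  have : 0 < rc e by rewrite -[0]/(rc 0) ltr_rc.
  by move/fl; apply: filterS => i; rewrite normr_cabs ltr_rc.
apply/cvgrPdist_lt => e /cplx_gt0[eE e0]; rewrite eE.
by have := fl _ e0; apply: filterS => i; rewrite normr_cabs ltr_rc.
Qed.

Lemma rc_cvg (I : Type) (F : set_system I) {FF : Filter F} (f : I -> R) l :
  f @ F --> l -> rc (f i) @[i --> F] --> rc l.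
Proof.
move=> /cvgrPdist_lt fl; apply/cplx_cvgP => e /fl; apply: filterS => i.
by rewrite /= -rcB cabs_rc.
Qed.

Lemma rd_cvg (I : Type) (F : set_system I) {FF : Filter F} (f : I -> H) l v :
  f @ F --> l -> rd (f i) v @[i --> F] --> rd l v.
Proof.
move=> /cvg_hnP fl; apply/cvgrPdist_lt => e e0.
have v1 : 0 < hn v + 1 by rewrite ltr_wpDl ?hn_ge0.
have := fl (e / (hn v + 1)) (divr_gt0 e0 v1); apply: filterS => i.
rewrite ltr_pdivlMr// -rdN -rdD => h; apply: (le_lt_trans _ h).
rewrite (@le_trans _ _ (hn (l - f i) * hn v))//; last first.
  by rewrite ler_wpM2l ?hn_ge0// lerDl.
rewrite ler_norml cauchy_schwarz andbT lerNl -rdN.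
by rewrite (le_trans (cauchy_schwarz _ _))// hnN.
Qed.

Lemma hn_cvg (I : Type) (F : set_system I) {FF : Filter F} (f : I -> H) l :
  f @ F --> l -> hn (f i) @[i --> F] --> hn l.
Proof.
move=> /cvg_hnP fl; apply/cvgrPdist_lt => e /fl; apply: filterS => i h.
apply: (le_lt_trans _ h); rewrite ler_norml.
have := hnD (l - f i) (f i); rewrite subrK => h1.
have := hnD (f i - l) l; rewrite subrK hn_distC => h2.
by apply/andP; split; lra.
Qed.

End InnerProduct.

Lemma cvg_le_bound (R : realType) (I : Type) (F : set_system I)
    {FF : ProperFilter F} (f : I -> R) (l M : R) :
  f @ F --> l -> (forall i, f i <= M) -> l <= M.
Proof.
move=> fl fM; rewrite -(cvg_lim _ fl)//; apply: limr_le; first exact: cvgP fl.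
exact: nearW.
Qed.

(** * Bounded operators: norm bounds, strong limits, uniqueness of adjoints *)

Section BoundedOperators.
Variables (R : realType) (H : hilbertType R).
Implicit Types (u v w : H) (A B : bop H).

Lemma bop_linear A : linear A.
Proof. by have /asboolP[] := bopP A. Qed.

HB.instance Definition _ A := GRing.isLinear.Build (Cx R) H H _ (bop_fun A) (bop_linear A).

Lemma bop_bounded A : exists2 M : R, 0 < M & forall u, hn (A u) <= M * hn u.
Proof.
have /asboolP[_ Ac] := bopP A.
have /cvg_hnP /(_ 1 ltr01) : A u @[u --> (0 : H)] --> A 0 by exact: Ac.
rewrite linear0 => /nbhs_ballP[d' /cplx_gt0[dE d0]]; rewrite dE => dA.
(* [d] is the radius of a ball mapped into the unit ball; a nonzero vector rescaled to norm [d / 2]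
   lies in it, which gives the constant [2 / d]. *)
set d := re d' in d0 dA; exists (2 / d) => [|u]; first by rewrite divr_gt0.
have [->|u0] := eqVneq u 0; first by rewrite linear0 hn0 mulr0.
have hu : 0 < hn u.
  rewrite lt_neqAle hn_ge0 andbT eq_sym; apply: contra u0 => /eqP/hn_eq0 ->.
  exact: eqxx.
have c0 : 0 < d / (2 * hn u) by rewrite divr_gt0// mulr_gt0.
have := dA (rc (d / (2 * hn u)) *: u).
rewrite -ball_normE /= !sub0r normrN hnormE ltr_rc hnN linearZ /= !hnZ cabs_rc gtr0_norm//.
have -> : d / (2 * hn u) * hn u = d / 2 by field; rewrite gt_eqF.
rewrite ltr_pdivrMr// ltr_pMr// ltr1n => /(_ isT) h.
have -> : hn (A u) = (2 / d * hn u) * (d / (2 * hn u) * hn (A u)).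
  by field; rewrite !gt_eqF.
by rewrite ler_piMr ?ltW// mulr_gt0// divr_gt0.
Qed.

Lemma bounded_is_bop (f : H -> H) (M : R) :
  linear f -> (forall u, hn (f u) <= M * hn u) -> f \in is_bop H.
Proof.
move=> fl fM; apply/asboolP; split=> // u; apply/cvg_hnP => e e0.
pose g : {linear H -> H} := HB.pack f (GRing.isLinear.Build (Cx R) H H _ f fl).
have M1 : 0 < `|M| + 1 by rewrite ltr_wpDl.
have /cvg_hnP /(_ (e / (`|M| + 1)) (divr_gt0 e0 M1)) : v @[v --> u] --> u by exact: cvg_id.
apply: filterS => v; rewrite ltr_pdivlMr// => h; apply: (le_lt_trans _ h).
rewrite -[f u]/(g u) -[f v]/(g v) -linearB /=.
rewrite (le_trans (fM _))// mulrC ler_wpM2l ?hn_ge0//.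
by rewrite (le_trans (ler_norm _))// lerDl.
Qed.

(** The uniform bound passes to the pointwise limit and makes it continuous; the square root and the
    polar factor arise in this way. *)
Lemma strong_limit (I : Type) (F : set_system I) {FF : ProperFilter F}
    (Y : I -> bop H) (M : R) :
  (forall u, cvg (Y i u @[i --> F])) ->
  (forall i u, hn (Y i u) <= M * hn u) ->
  exists Z : bop H, forall u, Y i u @[i --> F] --> Z u.
Proof.
move=> Yc YM; pose Z u := lim (Y i u @[i --> F]).
have Yl u : Y i u @[i --> F] --> Z u by exact: Yc.
have Zl : linear Z.
  move=> a u v; apply/cvg_lim => //.
  under eq_fun do rewrite linearP.
  by apply: cvgD; [apply: cvgZr|]; exact: Yl.
have ZM u : hn (Z u) <= M * hn u.
  by apply: (cvg_le_bound (hn_cvg (Yl u))) => i; exact: YM.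
exists (Bop (bounded_is_bop Zl ZM)); exact: Yl.
Qed.

Lemma adjoint_uniqueP A B : (forall u v, dot (A u) v = dot u (B v)) ->
  adjoint A = B.
Proof.
move=> AB; rewrite /adjoint; case: xgetP => [C _ /= AC|/(_ B)//].
apply/val_inj/funext => v; apply: rd_inj => w.
by rewrite rdC /rd -AC AB -/(rd _ _) rdC.
Qed.

End BoundedOperators.


(** * Orthonormal bases, Riesz representation and adjoints *)

Section FiniteSubsets.
Variable T : Type.
Implicit Types E F G : set T.

Lemma finite_subsets_filter E : ProperFilter (finite_subsets E).
Proof.
apply: filter_from_proper; last by move=> F [Ff FE]; exists F; split.
apply: filter_from_filter.
  by exists set0; split; [exact: finite_set0|exact: sub0set].
move=> F G [Ff FE] [Gf GE]; exists (F `|` G).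
  by split; [rewrite finite_setU|move=> x [/FE|/GE]].
by move=> K [Kf FGK KE]; split; split=> // x Fx; apply: FGK; [left|right].
Qed.

Lemma near_finite_subsets E G : finite_set G -> G `<=` E ->
  \forall F \near finite_subsets E, [/\ finite_set F, G `<=` F & F `<=` E].
Proof. by move=> Gf GE; exists G. Qed.

Lemma near_finite_subsets0 E :
  \forall F \near finite_subsets E, finite_set F /\ F `<=` E.
Proof. by exists set0; [split; [exact: finite_set0|exact: sub0set]|by move=> F [? _ ?]]. Qed.

End FiniteSubsets.

#[global] Existing Instance finite_subsets_filter.

Lemma fsum_le_esum (R : realType) (T : choiceType) (E : set T) (a : T -> R) F :
  (forall e, E e -> 0 <= a e) -> (\esum_(e in E) (a e)%:E < +oo)%E ->
  finite_set F -> F `<=` E ->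
  \sum_(e \in F) a e <= fine (\esum_(e in E) (a e)%:E).
Proof.
move=> a0 afin Ff FE; rewrite -lee_fin fineK -?fsumEFin//.
  by apply: ereal_sup_ubound; exists F.
by rewrite ge0_fin_numE//; apply: esum_ge0 => e Ee; rewrite lee_fin a0.
Qed.

(** Some finite [G] comes within [eps] of the supremum, and nonnegativity keeps every larger finite
    set there. This turns extended sums into limits along [finite_subsets], the form in which
    [trace] is defined. *)
Lemma esum_cvg (R : realType) (T : choiceType) (E : set T) (a : T -> R) :
  (forall e, E e -> 0 <= a e) ->
  (\esum_(e in E) (a e)%:E < +oo)%E ->
  \sum_(e \in F) a e @[F --> finite_subsets E] -->
    fine (\esum_(e in E) (a e)%:E).
Proof.
move=> a0 afin; set s := esum _ _.
have s0 : (0 <= s)%E by apply: esum_ge0 => e Ee; rewrite lee_fin a0.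
have sE : s = (fine s)%:E by rewrite fineK// ge0_fin_numE.
apply/cvgrPdist_lt => eps eps0.
have [|_ [G [Gf GE] <-]] := ub_ereal_sup_adherent eps0 (_ : s \is a fin_num).
  by rewrite ge0_fin_numE.
rewrite -[ereal_sup _]/s fsumEFin// [in X in X -> _]sE -EFinB lte_fin => sG.
have := near_finite_subsets Gf GE; apply: filterS => F [Ff GF FE].
rewrite ger0_norm ?subr_ge0 ?fsum_le_esum// ltrBlDr -ltrBlDl (lt_le_trans sG)//.
rewrite -lee_fin -!fsumEFin//; apply: lee_fsum_nneg_subset => //.
  by move=> e /[!inE]; exact: GF.
by move=> e /[!inE] /andP[_ /set_mem/FE]; rewrite lee_fin; exact: a0.
Qed.

Lemma esum_le_fin (R : realType) (T : choiceType) (E : set T) (a : T -> R) (M : R) :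
  (forall F, finite_set F -> F `<=` E -> \sum_(e \in F) a e <= M) ->
  (\esum_(e in E) (a e)%:E <= M%:E)%E.
Proof.
move=> aM; apply: ge_ereal_sup => _ [F [Ff FE] <-].
by rewrite fsumEFin// lee_fin aM.
Qed.

(** * Orthonormal systems and expansions, the Riesz representation, existence of adjoints *)

Section Orthonormal.
Variables (R : realType) (H : hilbertType R).
Implicit Types (u v w : H) (E F : set H) (c : H -> Cx R).

Definition orthonormal E := forall e f : H, E e -> E f -> dot e f = (e == f)%:R.

Definition fcomb c F := \sum_(e \in F) c e *: e.

Lemma dot_fcombl c F w : finite_set F ->
  dot (fcomb c F) w = \sum_(e \in F) c e * dot e w.
Proof.
move=> Ff; rewrite /fcomb !fsbig_finite//= dot_suml.
by apply: eq_bigr => e _; rewrite dotZl.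
Qed.

Lemma dot_fcomb E c F f : orthonormal E -> finite_set F -> F `<=` E ->
  E f -> dot (fcomb c F) f = if f \in F then c f else 0.
Proof.
move=> oE Ff FE Ef; rewrite dot_fcombl//; case: ifPn => [/set_mem fF|/negP fF].
  rewrite (fsbigD1 f)//= oE// eqxx mulr1 fsbig1 ?addr0// => e [Fe /= ef].
  by rewrite oE//; [case: eqP => [/ef//|_]; rewrite mulr0|exact: FE].
rewrite fsbig1// => e Fe; rewrite oE//; last exact: FE.
by case: eqP => [ef|_]; rewrite ?mulr0//; case: fF; rewrite -ef mem_set.
Qed.

Lemma rc_fsum (a : H -> R) F : finite_set F ->
  rc (\sum_(e \in F) a e) = \sum_(e \in F) rc (a e).
Proof. by move=> Ff; rewrite !fsbig_finite//= /rc rmorph_sum. Qed.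

Lemma pythagoras E c F : orthonormal E -> finite_set F -> F `<=` E ->
  hn (fcomb c F) ^+ 2 = \sum_(e \in F) cabs (c e) ^+ 2.
Proof.
move=> oE Ff FE; apply: rc_inj; rewrite rcX -hnormE -dot_norm dot_fcombl//.
rewrite rc_fsum//; apply: eq_fsbigr => e eF; have Fe := set_mem eF.
rewrite dot_conj (dot_fcomb _ oE)// ?eF; last exact: FE.
by rewrite rcX -normr_cabs normCK.
Qed.

Lemma fcombB c F G : finite_set F -> G `<=` F ->
  fcomb c F - fcomb c G = fcomb c (F `&` ~` G).
Proof.
move=> Ff GF; rewrite /fcomb (fsbigID G)//= setIidr// addrAC subrr add0r//.
Qed.

Lemma bessel E u F : orthonormal E -> finite_set F -> F `<=` E ->
  \sum_(e \in F) cabs (dot u e) ^+ 2 <= hn u ^+ 2.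
Proof.
move=> oE Ff FE; set c := fun e => dot u e.
have cu : rd (fcomb c F) u = \sum_(e \in F) cabs (dot u e) ^+ 2.
  rewrite -[RHS]re_rc rc_fsum// /rd dot_fcombl//; congr re.
  by apply: eq_fsbigr => e _; rewrite (dot_conj u e) -normCK normr_cabs -rcX.
have : 0 <= rd (u - fcomb c F) (u - fcomb c F) by rewrite rd_hn sqr_ge0.
rewrite !rdE (rdC u (fcomb _ _)) cu !rd_hn (pythagoras _ oE)//=.
by rewrite -/c => h; lra.
Qed.

(** Take a finite [G] whose sum of squares is within (eps / 2)^2 of the total. For [F] containing
    [G], the two combinations differ by one over [F] minus [G], whose squared norm is below (eps /
    2)^2 by Pythagoras. *)
Lemma riesz_fischer E c : orthonormal E ->
  (\esum_(e in E) (cabs (c e) ^+ 2)%:E < +oo)%E ->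
  cvg (fcomb c F @[F --> finite_subsets E]).
Proof.
move=> oE cfin; apply: cauchy_hn_cvg => eps eps0.
have e2 : 0 < eps / 2 by rewrite divr_gt0.
have /cvgrPdist_lt /(_ _ (exprn_gt0 2 e2)) := esum_cvg (fun e _ => sqr_ge0 (cabs (c e))) cfin.
move=> h; have [G [[Gf GE] Gs]] := filter_ex (filterI (near_finite_subsets0 E) h).
exists [set F | [/\ finite_set F, G `<=` F & F `<=` E]]; first exact: near_finite_subsets.
suff FG F : [/\ finite_set F, G `<=` F & F `<=` E] -> hn (fcomb c F - fcomb c G) < eps / 2.
  move=> F F' /FG h1 /FG h2; apply: (le_lt_trans (hn_tri (fcomb c G) _ _)).
  by rewrite (hn_distC _ (fcomb c F')); lra.
move=> [Ff GF FE].
rewrite -(ltr_pXn2r (ltn0Sn 1)) ?nnegrE ?hn_ge0 ?ltW// fcombB//.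
have FGf : finite_set (F `&` ~` G) by apply: finite_setI; left.
rewrite (pythagoras c oE)//; last by move=> e [/FE].
have := @fsum_le_esum _ _ E (fun e => cabs (c e) ^+ 2) F (fun e _ => sqr_ge0 _) cfin Ff FE.
have -> : \sum_(e \in F) cabs (c e) ^+ 2 = \sum_(e \in G) cabs (c e) ^+ 2
    + \sum_(e \in F `&` ~` G) cabs (c e) ^+ 2.
  by rewrite (fsbigID G)//= setIidr.
move: Gs => /ltr_normlP[_]; set s := fine _; set x := \sum_(e \in G) _; set y := \sum_(e \in _) _.
by move=> ? ?; lra.
Qed.

Lemma dot_cvg (I : Type) (F : set_system I) {FF : Filter F} (f : I -> H) l v :
  f @ F --> l -> dot (f i) v @[i --> F] --> dot l v.
Proof.
move=> /cvg_hnP fl; apply/cplx_cvgP => e e0.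
have v1 : 0 < hn v + 1 by rewrite ltr_wpDl ?hn_ge0.
have := fl (e / (hn v + 1)) (divr_gt0 e0 v1); apply: filterS => i.
rewrite ltr_pdivlMr// -dotBl => h; apply: (le_lt_trans _ h).
rewrite (le_trans (cauchy_schwarzC _ _))// ler_wpM2l ?hn_ge0// lerDl.
exact: ler01.
Qed.

Lemma dot_fcomb_lim E c l f : orthonormal E ->
  fcomb c F @[F --> finite_subsets E] --> l -> E f -> dot l f = c f.
Proof.
move=> oE cl Ef; have h1 : dot (fcomb c F) f @[F --> finite_subsets E] --> dot l f by exact: dot_cvg.
suff h2 : dot (fcomb c F) f @[F --> finite_subsets E] --> c f.
  by apply: (cvg_unique _ h1 h2); exact: norm_hausdorff.
apply: cvg_near_cst.
have fE : [set f] `<=` E by move=> _ ->.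
have := near_finite_subsets (finite_set1 f) fE.
apply: filterS => F [Ff fF FE]; rewrite (dot_fcomb c oE)// mem_set//.
exact: fF.
Qed.

(** Bessel and Riesz-Fischer give a limit [w] with the same coefficients as [u]; then [u - w] is
    orthogonal to the basis and vanishes by totality. *)
Lemma parseval E u : orthonormal_basis E ->
  fcomb (dot u) F @[F --> finite_subsets E] --> u.
Proof.
move=> [oE tE].
have ufin : (\esum_(e in E) (cabs (dot u e) ^+ 2)%:E < +oo)%E.
  apply: (@le_lt_trans _ _ (hn u ^+ 2)%:E); last exact: ltry.
  by apply: esum_le_fin => F Ff FE; exact: (bessel u oE).
have /cvg_ex[w wE] := riesz_fischer oE ufin.
suff uw : u = w by rewrite [X in _ --> X]uw; exact: wE.
apply/eqP; rewrite -subr_eq0; apply/eqP/tE => e Ee.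
by rewrite dotBl (dot_fcomb_lim oE wE Ee) subrr.
Qed.

Lemma parseval_esum E u : orthonormal_basis E ->
  (\esum_(e in E) (cabs (dot u e) ^+ 2)%:E)%E = (hn u ^+ 2)%:E.
Proof.
move=> bE; have [oE tE] := bE.
have ule : (\esum_(e in E) (cabs (dot u e) ^+ 2)%:E <= (hn u ^+ 2)%:E)%E.
  by apply: esum_le_fin => F Ff FE; exact: (bessel u oE).
have ufin := le_lt_trans ule (ltry _).
have u0 e : E e -> 0 <= cabs (dot u e) ^+ 2 by move=> _; exact: sqr_ge0.
have := esum_cvg u0 ufin.
have : hn (fcomb (dot u) F) ^+ 2 @[F --> finite_subsets E] --> hn u ^+ 2.
  by rewrite expr2; apply: cvgM; apply: hn_cvg; exact: parseval.
have h : \forall F \near finite_subsets E, 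
    hn (fcomb (dot u) F) ^+ 2 = \sum_(e \in F) cabs (dot u e) ^+ 2.
  by have := near_finite_subsets0 E; apply: filterS => F [Ff FE]; exact: (pythagoras _ oE).
move=> /(cvg_trans (near_eq_cvg h)) h1 h2.
by rewrite -(cvg_unique _ h2 h1)// fineK// ge0_fin_numE// esum_ge0.
Qed.

(** Zorn: a nonzero vector orthogonal to a maximal orthonormal system could be normalized and added
    to it. *)
Lemma orthonormal_basis_exists : exists E, orthonormal_basis E.
Proof.
have [|E [oE maxE]] := @Zorn_bigcup H [set E | orthonormal E].
  move=> C Co Ct e f [E CE Ee] [F CF Ff].
  by have [EF|FE] := Ct _ _ CE CF; [apply: (Co F) => //; exact: EF|apply: (Co E) => //; exact: FE].
exists E; split=> // u uE; apply/eqP/negPn/negP => u0.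
have hu : hn u != 0 by apply: contra u0 => /eqP/hn_eq0 ->.
pose e := rc (hn u)^-1 *: u.
have ee : dot e e = 1.
  rewrite dot_norm hnormE hnZ cabs_rc ger0_norm ?invr_ge0 ?hn_ge0// mulVf//.
  by rewrite -rcX expr1n.
have fe f : E f -> dot f e = 0 /\ dot e f = 0.
  move=> Ef; have h : dot e f = 0 by rewrite dotZl uE// mulr0.
  by rewrite dot_conj h rmorph0.
have nEe : ~ E e by move=> /fe; rewrite ee => -[/eqP]; rewrite oner_eq0.
apply: (maxE (E `|` [set e])).
  split; last by move=> /(_ e); apply: contra_not nEe; apply; right.
  by move=> f; left.
move=> f g [Ef|->] [Eg|->]; first exact: oE.
- by rewrite (fe _ Ef).1; case: eqP => // fE; rewrite fE in Ef.
- by rewrite (fe _ Eg).2; case: eqP => // fE; rewrite -fE in Eg.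
- by rewrite ee eqxx.
Qed.

Lemma onbP : orthonormal_basis (@onb R H).
Proof. by rewrite /onb; apply: xgetPex; exact: orthonormal_basis_exists. Qed.

Lemma riesz (phi : H -> Cx R) (M : R) : scalar phi ->
  (forall u, cabs (phi u) <= M * hn u) -> exists v, forall u, phi u = dot u v.
Proof.
move=> phil phiM; have bE := onbP; have [oE _] := bE.
pose f : {scalar H} := HB.pack phi (GRing.isLinear.Build (Cx R) H (Cx R) _ phi phil).
pose c e := (phi e)^*.
have fF d F : finite_set F -> phi (fcomb d F) = \sum_(e \in F) d e * phi e.
  move=> Ff; rewrite -[phi (fcomb _ _)]/(f (fcomb _ _)) /fcomb.
  rewrite !fsbig_finite// linear_sum; apply: eq_bigr => e _.
  by rewrite linearZ.
(* For the partial sum s of conj(phi(e)) e over [F] one has phi(s) = |s|^2, so |s|^2 <= M |s| and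
   hence |s|^2 <= M^2. *)
have cfin : (\esum_(e in onb H) (cabs (c e) ^+ 2)%:E < +oo)%E.
  apply: (@le_lt_trans _ _ (M ^+ 2)%:E); last exact: ltry.
  apply: esum_le_fin => F Ff FE; have pF := pythagoras c oE Ff FE.
  have : cabs (phi (fcomb c F)) = hn (fcomb c F) ^+ 2.
    rewrite fF// -[RHS]ger0_norm ?sqr_ge0// -cabs_rc pF rc_fsum//; congr cabs.
    apply: eq_fsbigr => e _; by rewrite rcX -normr_cabs normCK /c conjCK.
  have := phiM (fcomb c F); rewrite -pF; have := hn_ge0 (fcomb c F).
  by set h := hn _ => h0 /[swap] -> ?; nra.
have /cvg_ex[l cl] := riesz_fischer oE cfin.
exists l => u.
have ul : fcomb (dot u) F @[F --> finite_subsets (onb H)] --> u by exact: parseval.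
have h1 : dot (fcomb (dot u) F) l @[F --> finite_subsets (onb H)] --> dot u l.
  by exact: dot_cvg.
have h2 : phi (fcomb (dot u) F) @[F --> finite_subsets (onb H)] --> phi u.
  apply/cplx_cvgP => e e0.
  have M1 : 0 < `|M| + 1 by rewrite ltr_wpDl.
  move/cvg_hnP/(_ _ (divr_gt0 e0 M1)) : ul; apply: filterS => F.
  rewrite ltr_pdivlMr// => h; apply: (le_lt_trans _ h).
  have -> : phi u - phi (fcomb (dot u) F) = phi (u - fcomb (dot u) F).
    by rewrite -[RHS]/(f _) linearB.
  rewrite (le_trans (phiM _))// mulrC ler_wpM2l ?hn_ge0//.
  by rewrite (le_trans (ler_norm _))// lerDl.
have h3 : \forall F \near finite_subsets (onb H),
    phi (fcomb (dot u) F) = dot (fcomb (dot u) F) l.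
  have := near_finite_subsets0 (onb H); apply: filterS => F [Ff FE].
  rewrite fF// dot_fcombl//; apply: eq_fsbigr => e /set_mem/FE Ee.
  by rewrite (dot_conj l e) (dot_fcomb_lim oE cl Ee) /c conjCK.
have h4 : dot (fcomb (dot u) F) l @[F --> finite_subsets (onb H)] --> phi u.
  exact: cvg_trans (near_eq_cvg h3) h2.
by apply: (cvg_unique _ h4 h1); exact: norm_hausdorff.
Qed.

(** Riesz's theorem applied to u -> <A u, v> chooses [B v] for each [v]; the bound of [A] is
    inherited through |B v|^2 = <A (B v), v>. *)
Lemma adjoint_exists (A : bop H) :
  exists B : bop H, forall u v, dot (A u) v = dot u (B v).
Proof.
have [M M0 AM] := bop_bounded A.
have h v : exists w, forall u, dot (A u) v = dot u w.
  apply: (@riesz _ (M * hn v)) => [a u w|u].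
    by rewrite linearP dotDl dotZl.
  rewrite (le_trans (cauchy_schwarzC _ _))// mulrAC.
  by rewrite ler_wpM2r ?hn_ge0.
pose B v := projT1 (cid (h v)).
have BE u v : dot (A u) v = dot u (B v) by exact: (projT2 (cid (h v))).
have Bl : linear B.
  move=> a u v; apply: rd_inj => w.
  rewrite rdC (rdC (_ *: _ + _)) /rd; congr re.
  by rewrite -BE !dotDr !dotZr !BE.
have BM v : hn (B v) <= M * hn v.
  have [h0|h0] := eqVneq (hn (B v)) 0.
    by rewrite h0 mulr_ge0 ?hn_ge0// ltW.
  have hp : 0 < hn (B v) by rewrite lt_neqAle eq_sym h0 hn_ge0.
  rewrite -(ler_pM2r hp) -expr2 -rd_hn /rd -BE -/(rd _ _).
  rewrite (le_trans (cauchy_schwarz _ _))// mulrAC.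
  by rewrite ler_wpM2r ?hn_ge0.
by exists (Bop (bounded_is_bop Bl BM)) => u v; rewrite BE.
Qed.

Lemma dot_adjoint (A : bop H) u v : dot (A u) v = dot u (adjoint A v).
Proof. by have [B AB] := adjoint_exists A; rewrite (adjoint_uniqueP AB). Qed.

Lemma rd_adjoint (A : bop H) u v : rd (A u) v = rd u (adjoint A v).
Proof. by rewrite /rd dot_adjoint. Qed.

End Orthonormal.

(** * Positive operators, square roots and polar factorization *)

Section PositiveOperators.
Variables (R : realType) (H : hilbertType R).
Implicit Types (u v w : H) (A B P Q : bop H) (c : Cx R) (s : R).

Lemma bop_ext A B : A =1 B -> A = B.
Proof. by move=> AB; apply/val_inj/funext. Qed.

Lemma hn_adjoint A (M : R) : 0 <= M -> (forall u, hn (A u) <= M * hn u) ->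
  forall u, hn (adjoint A u) <= M * hn u.
Proof.
move=> M0 AM v; have [->|h0] := eqVneq (hn (adjoint A v)) 0.
  by rewrite mulr_ge0 ?hn_ge0.
have hp : 0 < hn (adjoint A v) by rewrite lt_neqAle eq_sym h0 hn_ge0.
rewrite -(ler_pM2r hp) -expr2 -rd_hn -rd_adjoint.
by rewrite (le_trans (cauchy_schwarz _ _))// mulrAC ler_wpM2r ?hn_ge0.
Qed.

Lemma dot_adjointl A u v : dot (adjoint A u) v = dot u (A v).
Proof. by rewrite dot_conj -dot_adjoint -dot_conj. Qed.

Lemma adjointK A : adjoint (adjoint A) = A.
Proof. by apply: adjoint_uniqueP => u v; exact: dot_adjointl. Qed.

Lemma adjoint_comp A B : adjoint (comp_op A B) = comp_op (adjoint B) (adjoint A).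
Proof. by apply: adjoint_uniqueP => u v /=; rewrite !dot_adjoint. Qed.

Lemma adjointD A B : adjoint (A + B) = adjoint A + adjoint B.
Proof.
apply: adjoint_uniqueP => u v; rewrite -[(A + B) u]/(A u + B u).
rewrite -[(adjoint A + adjoint B) v]/(adjoint A v + adjoint B v).
by rewrite dotDl dotDr !dot_adjoint.
Qed.

Lemma adjointZ c A : adjoint (c *: A) = c^* *: adjoint A.
Proof.
apply: adjoint_uniqueP => u v; rewrite -[(c *: A) u]/(c *: A u).
rewrite -[(_ *: adjoint A) v]/(c^* *: adjoint A v).
by rewrite dotZl dotZr dot_adjoint conjCK.
Qed.

Lemma hn_unitary A : unitary_op A -> forall u, hn (A u) = hn u.
Proof.
move=> [AK _] u; apply/eqP; rewrite -(@eqrXn2 _ 2) ?hn_ge0// -!rd_hn.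
by rewrite rd_adjoint AK.
Qed.

Lemma hn_unitary_adjoint A : unitary_op A -> forall u, hn (adjoint A u) = hn u.
Proof. by move=> Au u; rewrite -[in RHS](Au.2 u) (hn_unitary Au). Qed.

Lemma ic_sqr : ic R * ic R = -1.
Proof. by rewrite -expr2; exact: (sqr_i R). Qed.

Lemma ic_conj : (ic R)^* = - ic R.
Proof.
by rewrite -[LHS]/(Complex 0 (-1)) -[RHS]/(Complex (-0) (-1)) oppr0.
Qed.

Lemma icic u : ic R *: (ic R *: u) = - u.
Proof. by rewrite scalerA ic_sqr scaleN1r. Qed.

Lemma rd_ii u v : rd (ic R *: u) (ic R *: v) = rd u v.
Proof. by rewrite /rd dotZl dotZr mulrA ic_conj mulrN ic_sqr opprK mul1r. Qed.

Lemma rd_i u v : rd (ic R *: u) v = - rd u (ic R *: v).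
Proof. by rewrite -rd_ii icic rdN. Qed.

Lemma selfadjoint_dot A u : (forall u v, rd (A u) v = rd u (A v)) ->
  dot (A u) u = rc (rd (A u) u).
Proof.
move=> sA; rewrite dotE (_ : rd (A u) (ic R *: u) = 0) ?mulr0 ?addr0//.
have : rd (A u) (ic R *: u) = - rd (A u) (ic R *: u).
  by rewrite {1}sA linearZ/= rdC rd_i.
by lra.
Qed.

Lemma positive_ge0 P u : positive_op P -> 0 <= rd (P u) u.
Proof. by move=> /(_ u)/cplx_ge0[]. Qed.

(** Positivity forces Im <P w, w> = 0 for every w; at w = u - i v the cross terms of this identity
    are the claim. *)
Lemma positive_selfadjoint P : positive_op P ->
  forall u v, rd (P u) v = rd u (P v).
Proof.
move=> Pp; have h w : rd (P w) (ic R *: w) = 0.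
  by rewrite -im_dot; have /cplx_ge0[->] := Pp w.
move=> u v; have := h (u - ic R *: v).
have -> : P (u - ic R *: v) = P u - ic R *: P v by rewrite linearB linearZ.
rewrite scalerBr icic opprK !rdE h rd_ii rd_i h.
by rewrite (rdC u (P v)); lra.
Qed.

Lemma positive_adjoint P : positive_op P -> adjoint P = P.
Proof.
move=> Pp; apply: adjoint_uniqueP => u v.
by rewrite !dotE !(positive_selfadjoint Pp) linearZ.
Qed.

(** The quadratic form of P^2 <= M P, obtained by testing positivity on u - M^-1 P u. *)
Lemma positive_hn_le P (M : R) : positive_op P -> 0 < M ->
  (forall u, hn (P u) <= M * hn u) ->
  forall u, hn (P u) ^+ 2 <= M * rd (P u) u.
Proof.
move=> Pp M0 PM u; have := positive_ge0 (u - rc M^-1 *: P u) Pp.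
rewrite linearB linearZ/= !rdE !rd_hn (positive_selfadjoint Pp (P u) u) rd_hn.
have : rd (P (P u)) (P u) <= M * hn (P u) ^+ 2.
  rewrite (le_trans (cauchy_schwarz _ _))// expr2 mulrA ler_wpM2r ?hn_ge0//.
set a := rd (P (P u)) _; set b := hn _ ^+ 2; set d := rd (P u) u => h1 h2.
have h3 : 0 <= M * d - b - b + M^-1 * a.
  have := mulr_ge0 (ltW M0) h2.
  by congr (0 <= _); field; rewrite gt_eqF.
have h4 : M^-1 * a <= b by rewrite ler_pdivrMl.
lra.
Qed.

End PositiveOperators.

(** * Square roots of positive operators and the polar factor *)

Section SquareRoot.
Variables (R : realType) (H : hilbertType R).
Implicit Types (u v w : H) (A T P Q : bop H).

Definition id_op : bop H.
Proof.
apply: (@Bop _ _ idfun); apply: (@bounded_is_bop _ _ _ 1) => // u.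
by rewrite mul1r.
Defined.

(* The operators Y_(n+1) = (X + Y_n^2) / 2 converge to Y with (1 - Y)^2 = 1 - X;
   for |X| <= 1 the real sequence y_(n+1) = (1 + y_n^2) / 2 majorizes them:
   |Y_(n+1) - Y_n| <= y_(n+1) - y_n. *)
Fixpoint sqrt_scal (n : nat) : R :=
  if n is k.+1 then (1 + sqrt_scal k ^+ 2) / 2 else 0.

Fixpoint sqrt_iter (X : bop H) (n : nat) : bop H :=
  if n is k.+1 then rc (1 / 2) *: (X + comp_op (sqrt_iter X k) (sqrt_iter X k))
  else 0.

Lemma sqrt_scal_itv n : 0 <= sqrt_scal n <= 1.
Proof.
elim: n => [|n /andP[h0 h1]] /=; first by rewrite lexx ler01.
by apply/andP; split; nra.
Qed.

Lemma sqrt_scal_nd : nondecreasing_seq sqrt_scal.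
Proof.
apply/nondecreasing_seqP; elim=> [|n IH] /=; first by rewrite expr0n /= addr0 divr_ge0.
have /andP[h0 h1] := sqrt_scal_itv n.
move: IH; rewrite /=; set y := sqrt_scal n in h0 h1 *; set z := (1 + _) / 2 => yz.
have : 0 <= (z - y) * (z + y) by apply: mulr_ge0; lra.
have zE : z = (1 + y ^+ 2) / 2 by []. lra.
Qed.

Lemma sqrt_scal_cvg : cvg (sqrt_scal @ \oo).
Proof.
apply: (nondecreasing_is_cvgn sqrt_scal_nd); exists 1 => _ [n _ <-].
by have /andP[] := sqrt_scal_itv n.
Qed.

Section Iteration.
Variable X : bop H.
Hypothesis X1 : forall u, hn (X u) <= hn u.
Let Y := sqrt_iter X.

Lemma sqrt_iterS n u : Y n.+1 u = rc (1 / 2) *: (X u + Y n (Y n u)).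
Proof. by []. Qed.

Lemma cabs_half : cabs (rc (1 / 2 : R)) = 1 / 2.
Proof. by rewrite cabs_rc ger0_norm. Qed.

Lemma hn_sqrt_iter n u : hn (Y n u) <= sqrt_scal n * hn u.
Proof.
elim: n u => [|n IH] u; first by rewrite -[Y 0 u]/(0 : H) hn0 mul0r.
have /andP[y0 y1] := sqrt_scal_itv n.
rewrite sqrt_iterS hnZ cabs_half /=.
have h1 := hnD (X u) (Y n (Y n u)).
have h2 := IH (Y n u); have h3 := IH u; have h4 := X1 u.
have h5 : hn (Y n (Y n u)) <= sqrt_scal n ^+ 2 * hn u.
  by rewrite (le_trans h2)// expr2 -mulrA ler_wpM2l.
lra.
Qed.

Lemma hn_sqrt_iter1 n u : hn (Y n u) <= hn u.
Proof.
have /andP[y0 y1] := sqrt_scal_itv n.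
by rewrite (le_trans (hn_sqrt_iter n u))// ler_piMl ?hn_ge0.
Qed.

(** [X] cancels in the difference, leaving half of Y_(n+1) (Y_(n+1) - Y_n) + (Y_(n+1) - Y_n) Y_n.
    The scalars obey the matching identity y_(n+2) - y_(n+1) = (y_(n+1) + y_n) (y_(n+1) - y_n) / 2,
    so the induction closes. *)
Lemma hn_sqrt_iter_step n u :
  hn (Y n.+1 u - Y n u) <= (sqrt_scal n.+1 - sqrt_scal n) * hn u.
Proof.
elim: n u => [|n IH] u.
  by rewrite -[Y 0 u]/(0 : H) subr0 -[sqrt_scal 0]/(0 : R) subr0 hn_sqrt_iter.
have /andP[y0 y1] := sqrt_scal_itv n; have /andP[z0 z1] := sqrt_scal_itv n.+1.
have yz : sqrt_scal n <= sqrt_scal n.+1 by exact: sqrt_scal_nd.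
rewrite {1}sqrt_iterS [Y n.+1 u in X in _ - X]sqrt_iterS -scalerBr hnZ cabs_half.
have -> : X u + Y n.+1 (Y n.+1 u) - (X u + Y n (Y n u)) =
    Y n.+1 (Y n.+1 u - Y n u) + (Y n.+1 (Y n u) - Y n (Y n u)).
  by rewrite linearB/= opprD addrACA subrr add0r addrA subrK.
have h1 := hnD (Y n.+1 (Y n.+1 u - Y n u)) (Y n.+1 (Y n u) - Y n (Y n u)).
have h2 := hn_sqrt_iter n.+1 (Y n.+1 u - Y n u).
have h3 := ler_wpM2l z0 (IH u).
have yz0 : 0 <= sqrt_scal n.+1 - sqrt_scal n by rewrite subr_ge0.
have h4 := le_trans (IH (Y n u)) (ler_wpM2l yz0 (hn_sqrt_iter n u)).
have -> : sqrt_scal n.+2 - sqrt_scal n.+1 =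
    (sqrt_scal n.+1 + sqrt_scal n) * (sqrt_scal n.+1 - sqrt_scal n) / 2.
  have : sqrt_scal n.+1 = (1 + sqrt_scal n ^+ 2) / 2 by [].
  rewrite -[sqrt_scal n.+2]/((1 + sqrt_scal n.+1 ^+ 2) / 2).
  set z := sqrt_scal n.+1; set y := sqrt_scal n => zE; lra.
move: h1 h2 h3 h4; set z := sqrt_scal n.+1; set y := sqrt_scal n; lra.
Qed.

Lemma hn_sqrt_iterB m n u : (n <= m)%N ->
  hn (Y m u - Y n u) <= (sqrt_scal m - sqrt_scal n) * hn u.
Proof.
elim: m => [|m IH]; first by rewrite leqn0 => /eqP ->; rewrite !subrr hn0 mul0r.
rewrite leq_eqVlt => /orP[/eqP ->|]; first by rewrite !subrr hn0 mul0r.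
move=> /IH h1; have h2 := hn_sqrt_iter_step m u.
have h3 := hn_tri (Y m u) (Y m.+1 u) (Y n u); lra.
Qed.

Lemma sqrt_iter_cvg u : cvg (Y n u @[n --> \oo]).
Proof.
apply: cauchy_hn_cvg => e e0.
have u1 : 0 < hn u + 1 by rewrite ltr_wpDl ?hn_ge0.
have [d d0 dE] : exists2 d, 0 < d & d * (hn u + 1) = e / 2.
  by exists (e / 2 / (hn u + 1)); [rewrite !divr_gt0|rewrite divfK// gt_eqF].
have /cvgrPdist_lt /(_ d d0) [N _ hN] := sqrt_scal_cvg.
exists [set n | (N <= n)%N]; first by exists N.
suff h n : (N <= n)%N -> hn (Y n u - Y N u) < e / 2.
  move=> i j /= /h h1 /h h2; apply: (le_lt_trans (hn_tri (Y N u) _ _)).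
  by rewrite (hn_distC _ (Y j u)); lra.
move=> Nn; apply: (le_lt_trans (hn_sqrt_iterB u Nn)); rewrite -dE.
have h1 := hN _ Nn; have h2 := hN N (leqnn N); have h3 := hn_ge0 u.
rewrite /= in h1 h2.
have le_l k : sqrt_scal k <= lim (sqrt_scal @ \oo).
  by apply: nondecreasing_cvgn_le; [exact: sqrt_scal_nd|exact: sqrt_scal_cvg].
have := le_l n; have := le_l N.
move: h1 h2 => /ltr_normlP[h1 h1'] /ltr_normlP[h2 h2'].
have := sqrt_scal_nd Nn; rewrite -[_ <= _]/(sqrt_scal N <= sqrt_scal n).
set l := lim _ in h1 h1' h2 h2' *; set a := sqrt_scal N in h1 h1' h2 h2' *; set b := sqrt_scal n in h1 h1' h2 h2' *.
move=> ab la lb.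
have k1 : b - a < d by lra.
rewrite (le_lt_trans (ler_wpM2l _ (_ : hn u <= hn u + 1)))//; [lra|lra|].
by rewrite ltr_pM2r.
Qed.

End Iteration.

Lemma sqrt_contraction (X : bop H) : (forall u, hn (X u) <= hn u) ->
  (forall u v, rd (X u) v = rd u (X v)) ->
  exists Y : bop H, [/\ forall u, hn (Y u) <= hn u,
    forall u v, rd (Y u) v = rd u (Y v) &
    forall u, Y u = rc (1 / 2) *: (X u + Y (Y u))].
Proof.
move=> X1 Xs; set Yn := sqrt_iter X.
have Yn1 n u : hn (Yn n u) <= 1 * hn u by rewrite mul1r; exact: hn_sqrt_iter1.
have [Y YE] := strong_limit (sqrt_iter_cvg X1) Yn1.
exists Y; split.
- by move=> u; apply: (cvg_le_bound (hn_cvg (YE u))) => n; rewrite -[leRHS]mul1r; exact: Yn1.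
- move=> u v.
  have h n : forall u v, rd (Yn n u) v = rd u (Yn n v).
    elim: n => [|n IH] a b; first by rewrite -[Yn 0 a]/(0 : H) -[Yn 0 b]/(0 : H) rd0 rdC rd0.
    by rewrite /Yn !sqrt_iterS -/Yn !rdE Xs !IH.
  have h1 : rd (Yn n u) v @[n --> \oo] --> rd (Y u) v by exact: rd_cvg.
  have h2 : rd (Yn n u) v @[n --> \oo] --> rd u (Y v).
    have -> : (fun n => rd (Yn n u) v) = (fun n => rd (Yn n v) u).
      by apply/funext => n; rewrite h rdC.
    by rewrite rdC; exact: rd_cvg.
  by apply: (cvg_unique _ h1 h2); exact: norm_hausdorff.
- move=> u.
  have h1 : Yn n.+1 u @[n --> \oo] --> Y u.
    by have := YE u; rewrite -(cvg_shiftS (fun n => Yn n u)).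
  have h2 : Yn n.+1 u @[n --> \oo] --> rc (1 / 2) *: (X u + Y (Y u)).
    apply: cvgZr; apply: cvgD; first exact: cvg_cst.
    (* The squares converge strongly because the iterates are contractions: |Y Y u - Y_n Y_n u| <=
       |(Y - Y_n) Y u| + |Y_n (Y u - Y_n u)|. *)
    apply/cvg_hnP => e e0; have e2 : 0 < e / 2 by rewrite divr_gt0.
    have /cvg_hnP/(_ _ e2) k1 := YE (Y u); have /cvg_hnP/(_ _ e2) k2 := YE u.
    near=> n.
    have j1 : hn (Y (Y u) - Yn n (Y u)) < e / 2 by near: n.
    have j2 : hn (Y u - Yn n u) < e / 2 by near: n.
    have j3 := hn_tri (Yn n (Y u)) (Y (Y u)) (Yn n (Yn n u)).
    have j4 := Yn1 n (Y u - Yn n u); rewrite linearB/= in j4.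
    lra.
  by apply: (cvg_unique _ h1 h2); exact: norm_hausdorff.
Unshelve. all: by end_near.
Qed.

Lemma sqrt_exists T : positive_op T ->
  exists S : bop H, positive_op S /\ comp_op S S = T.
Proof.
move=> Tp; have [M M0 TM] := bop_bounded T.
have Ts := positive_selfadjoint Tp.
(* Dividing by the bound [M] makes X = 1 - T / M a contraction, by [positive_hn_le]; then (1 - Y)^2
   = 1 - X = T / M, and the root of [T] is sqrt(M) (1 - Y). *)
pose X := id_op - rc M^-1 *: T.
have XE u : X u = u - rc M^-1 *: T u by [].
have [||Y [Y1 Ys YE]] := @sqrt_contraction X.
- move=> u; rewrite -(@ler_pXn2r _ 2) ?nnegrE ?hn_ge0// -!rd_hn XE !rdE.
  rewrite (rdC u (T u)) (rd_hn (T u)).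
  have h1 := positive_hn_le Tp M0 TM u; have h2 := positive_ge0 u Tp.
  have s0 : 0 <= M^-1 by rewrite invr_ge0 ltW.
  have h3 : M^-1 * hn (T u) ^+ 2 <= rd (T u) u by rewrite ler_pdivrMl.
  have h4 := ler_wpM2l s0 h3; have h5 := mulr_ge0 s0 h2.
  lra.
- by move=> u v; rewrite !XE !rdE Ts.
pose S := rc (Num.sqrt M) *: (id_op - Y).
have SE u : S u = rc (Num.sqrt M) *: (u - Y u) by [].
exists S; split.
  move=> u; rewrite selfadjoint_dot; last by move=> v w; rewrite !SE !rdE Ys.
  rewrite rc_ge0 SE !rdE mulr_ge0// ?sqrtr_ge0//.
  have := cauchy_schwarz (Y u) u; rewrite rd_hn.
  have := Y1 u; have := hn_ge0 u; nra.
apply: bop_ext => u; rewrite -[LHS]/(S (S u)) SE SE.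
have -> : Y (rc (Num.sqrt M) *: (u - Y u)) = rc (Num.sqrt M) *: (Y u - Y (Y u)).
  by rewrite linearZ linearB.
have YY : Y (Y u) = Y u + Y u - X u.
  rewrite [in RHS]YE -scalerDl -rcD.
  rewrite (_ : 1 / 2 + 1 / 2 = 1 :> R); last by lra.
  by rewrite scale1r addrAC subrr add0r.
rewrite -scalerBr scalerA -rcM -expr2 sqr_sqrtr ?ltW// YY XE.
have -> : Y u - (Y u + Y u - (u - rc M^-1 *: T u)) = u - rc M^-1 *: T u - Y u.
  by rewrite opprB opprD addrCA (addrA (Y u)) subrr add0r.
rewrite opprB addrA subrK opprB addrC subrK scalerA -rcM divff ?gt_eqF//.
by rewrite scale1r.
Qed.

(** Formally W = A Q^-1, with [G n] a truncated Neumann series for the inverse: Q G_n = 1 - L^n. The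
    hypothesis turns |A G_n u| into |Q u - Q L^n u|, so every limit reduces to Q L^n u -> 0, which
    holds even if [Q] has a kernel. *)
Lemma polar_factorization A Q : positive_op Q ->
  (forall u, hn (A u) = hn (Q (Q u))) ->
  exists2 W : bop H, A = comp_op W Q & forall u, hn (W u) = hn (Q u).
Proof.
move=> Qp AQ; have [M M0 QM] := bop_bounded Q.
(* With this [t], [positive_hn_le] gives t |Q v|^2 <= <Q v, v>, hence |v|^2 - |L v|^2 >= (t |Q
   v|)^2, the content of [step]. *)
pose t := M^-1; have t0 : 0 < t by rewrite invr_gt0.
pose L := id_op - rc t *: Q.
have LE u : L u = u - rc t *: Q u by [].
pose Lp n := iter n (comp_op L) id_op.
have LpS n u : Lp n.+1 u = L (Lp n u) by [].
pose G n := iteri n (fun k B => B + rc t *: Lp k) (0 : bop H).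
have GS n u : G n.+1 u = G n u + rc t *: Lp n u by [].
have QLp n u : Q (Lp n u) = Lp n (Q u).
  elim: n u => [//|n IH] u; rewrite !LpS !LE -IH.
  by rewrite linearB linearZ.
have QG n u : Q (G n u) = u - Lp n u.
  elim: n u => [|n IH] u; first by rewrite -[G 0 u]/(0 : H) linear0 subrr.
  rewrite GS LpS LE linearD linearZ/= IH.
  by rewrite opprB addrA addrAC.
have GQ n u : G n (Q u) = u - Lp n u.
  elim: n u => [|n IH] u; first by rewrite subrr.
  by rewrite GS LpS LE IH -QLp opprB addrA addrAC.
have step n u : (t * hn (Q (Lp n u))) ^+ 2 <=
    hn (Lp n u) ^+ 2 - hn (Lp n.+1 u) ^+ 2.
  rewrite LpS LE; set v := Lp n u; rewrite -[hn (v - _) ^+ 2]rd_hn !rdE.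
  rewrite (rdC v (Q v)) !rd_hn.
  have h1 := positive_hn_le Qp M0 QM v.
  have h3 : t * hn (Q v) ^+ 2 <= rd (Q v) v by rewrite ler_pdivrMl.
  have h4 := ler_wpM2l (ltW t0) h3; lra.
have Lp_nonincr u : nonincreasing_seq (fun n => hn (Lp n u) ^+ 2).
  apply/nonincreasing_seqP => n; rewrite -subr_ge0.
  by apply: le_trans (step n u); exact: sqr_ge0.
have Lp1 n u : hn (Lp n u) <= hn u.
  rewrite -(@ler_pXn2r _ 2) ?nnegrE ?hn_ge0//.
  exact: (Lp_nonincr u 0%N n).
(* The decreasing sequence |L^n u|^2 converges, so its consecutive differences tend to 0, and by
   [step] they dominate (t |Q L^n u|)^2. *)
have QL0 u : hn (Q (Lp n u)) @[n --> \oo] --> (0 : R).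
  have := nonincreasing_is_cvgn (Lp_nonincr u).
  move=> /(_ (ex_intro _ 0 _)) => cv.
  apply/cvgrPdist_lt => e e0.
  have d0 : 0 < (t * e) ^+ 2 / 2 by rewrite divr_gt0// exprn_gt0// mulr_gt0.
  have /cvgrPdist_lt/(_ _ d0)[N _ hN] := cv ltac:(by move=> _ [n _ <-]; exact: sqr_ge0).
  exists N => // n /= Nn; rewrite sub0r normrN ger0_norm ?hn_ge0//.
  have /ltr_normlP[h1 h1'] := hN n Nn; have /ltr_normlP[h2 h2'] := hN n.+1 (leqW Nn).
  rewrite -(ltr_pM2l t0) -(@ltr_pXn2r _ 2) ?nnegrE ?mulr_ge0 ?hn_ge0 ?(ltW t0) ?(ltW e0)//.
  rewrite (le_lt_trans (step n u))//; lra.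
pose W n := comp_op A (G n).
have WE n u : W n u = A (G n u) by [].
have hW n u : hn (W n u) = hn (Q u - Q (Lp n u)) by rewrite WE AQ QG linearB.
have WM n u : hn (W n u) <= (2 * M) * hn u.
  rewrite hW -linearB (le_trans (QM _))// mulrAC mulrC ler_wpM2r ?(ltW M0)//.
  by have := hnD u (- Lp n u); have := Lp1 n u; rewrite hnN; lra.
have Wc u : cvg (W n u @[n --> \oo]).
  apply: cauchy_hn_cvg => e e0; have e2 : 0 < e / 2 by rewrite divr_gt0.
  have /cvgrPdist_lt/(_ _ e2)[N _ hN] := QL0 u.
  exists [set n | (N <= n)%N]; first by exists N.
  move=> i j Ni Nj; rewrite !WE -linearB AQ linearB/= !QG.
  rewrite (_ : _ - _ = Lp j u - Lp i u); last by rewrite opprB addrC subrKA.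
  rewrite linearB (le_lt_trans (hnD _ _))// hnN.
  have := hN i Ni; have := hN j Nj; rewrite /= !sub0r !normrN !ger0_norm ?hn_ge0//; lra.
have [W' W'E] := strong_limit Wc WM.
exists W'.
  apply: bop_ext => u.
  have h1 : A (G n (Q u)) @[n --> \oo] --> W' (Q u) by exact: W'E.
  have h2 : A (G n (Q u)) @[n --> \oo] --> A u.
    apply/cvg_hnP => e e0; have eM : 0 < e / M by rewrite divr_gt0.
    have /cvgrPdist_lt/(_ _ eM) := QL0 u; apply: filterS => n.
    rewrite GQ (linearB A) subKr AQ sub0r normrN ger0_norm ?hn_ge0//.
    by rewrite ltr_pdivlMr// mulrC => h; rewrite (le_lt_trans (QM _)).
  by apply: (cvg_unique _ h2 h1); exact: norm_hausdorff.
move=> u.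
have h1 : hn (W n u) @[n --> \oo] --> hn (W' u) by exact: hn_cvg.
have h2 : hn (W n u) @[n --> \oo] --> hn (Q u).
  apply/cvgrPdist_lt => e e0.
  have /cvgrPdist_lt/(_ _ e0) := QL0 u; apply: filterS => n.
  rewrite sub0r normrN ger0_norm ?hn_ge0// hW => h; apply: (le_lt_trans _ h).
  have k1 := hn_tri (Q u - Q (Lp n u)) (Q u) 0; rewrite !subr0 subKr in k1.
  have k2 := hnD (Q u) (- Q (Lp n u)); rewrite hnN in k2.
  by rewrite ler_norml; apply/andP; split; lra.
by apply: (cvg_unique _ h1 h2); exact: norm_hausdorff.
Qed.

End SquareRoot.

(** * Hilbert-Schmidt operators and traces of their products *)

Section EsumFacts.
Variable R : realType.

Lemma esum_leP (T : choiceType) (E : set T) (a : T -> R) (M : R) :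
  (\esum_(e in E) (a e)%:E <= M%:E)%E <->
  forall F, finite_set F -> F `<=` E -> \sum_(e \in F) a e <= M.
Proof.
split=> [/ereal_supP h F Ff FE|]; last exact: esum_le_fin.
by rewrite -lee_fin -fsumEFin//; apply: h; exists F.
Qed.

Lemma ler_fsum (T : choiceType) (F : set T) (a b : T -> R) : finite_set F ->
  (forall e, F e -> a e <= b e) -> \sum_(e \in F) a e <= \sum_(e \in F) b e.
Proof.
by move=> Ff ab; rewrite -lee_fin -!fsumEFin//; apply: lee_fsum.
Qed.

Lemma esum_swap (T1 T2 : choiceType) (I : set T1) (J : set T2)
    (a : T1 -> T2 -> \bar R) :
  (forall i j, I i -> J j -> (0 <= a i j)%E) ->
  \esum_(i in I) \esum_(j in J) a i j = \esum_(j in J) \esum_(i in I) a i j.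
Proof.
move=> a0; rewrite !esum_esum//; last by move=> i j ? ?; exact: a0.
rewrite (reindex_esum (J `*`` (fun=> I)) _ (fun k => (k.2, k.1)))//.
split=> [[j i] [Jj Ii]|[j i] [j' i'] _ _ [-> ->]|[i j] [Ii Jj]] //.
by exists (j, i).
Qed.

Lemma cabs_fsum (T : choiceType) (F : set T) (f : T -> Cx R) : finite_set F ->
  cabs (\sum_(e \in F) f e) <= \sum_(e \in F) cabs (f e).
Proof.
move=> Ff; rewrite !fsbig_finite//=.
elim/big_rec2: _ => [|e x y _ h]; first by rewrite cabs_rc normr0.
by rewrite (le_trans (cabsD _ _))// lerD2l.
Qed.

Lemma cplx_cvg_bound (I : Type) (F : set_system I) {FF : ProperFilter F}
    (f : I -> Cx R) l (M : R) :
  f @ F --> l -> (\forall i \near F, cabs (f i) <= M) -> cabs l <= M.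
Proof.
move=> /cplx_cvgP fl fM; rewrite leNgt; apply/negP => Ml.
have := fl (cabs l - M); rewrite subr_gt0 => /(_ Ml) h.
have [i [h1 h2]] := filter_ex (filterI h fM).
by have := cabsD (l - f i) (f i); rewrite subrK; lra.
Qed.

End EsumFacts.

Section HilbertSchmidt.
Variables (R : realType) (H : hilbertType R).
Implicit Types (u v w : H) (A B S T D : bop H) (c : Cx R).

Definition hs2 A : \bar R := \esum_(e in @onb R H) (hn (A e) ^+ 2)%:E.

(** Parseval writes both sides as the double sum of |<A e, f>|^2, and nonnegative sums may be
    swapped. *)
Lemma hs2_adjoint A : hs2 (adjoint A) = hs2 A.
Proof.
rewrite /hs2; under eq_esum do rewrite -(parseval_esum _ (@onbP R H)).
under [RHS]eq_esum do rewrite -(parseval_esum _ (@onbP R H)).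
rewrite esum_swap; last by move=> e f _ _; rewrite lee_fin sqr_ge0.
apply: eq_esum => e _; apply: eq_esum => f _; congr (_ ^+ 2)%:E.
rewrite dot_adjointl dot_conj; apply: rc_inj.
by rewrite -!normr_cabs norm_conjC.
Qed.

Lemma hs2_compl A D (M a : R) : (forall u, hn (D u) <= M * hn u) ->
  (hs2 A <= a%:E)%E -> (hs2 (comp_op D A) <= (M ^+ 2 * a)%:E)%E.
Proof.
move=> DM /esum_leP Aa; apply/esum_leP => F Ff FE.
apply: (@le_trans _ _ (M ^+ 2 * \sum_(e \in F) hn (A e) ^+ 2)).
  rewrite mulr_fsumr; apply: ler_fsum => // e _ /=.
  rewrite -exprMn ler_pXn2r ?nnegrE ?hn_ge0//.
  by rewrite (le_trans (hn_ge0 _) (DM _)).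
by rewrite ler_wpM2l ?sqr_ge0// Aa.
Qed.

Lemma hs2_compr A D (M a : R) : 0 <= M -> (forall u, hn (D u) <= M * hn u) ->
  (hs2 A <= a%:E)%E -> (hs2 (comp_op A D) <= (M ^+ 2 * a)%:E)%E.
Proof.
move=> M0 DM Aa; rewrite -hs2_adjoint adjoint_comp; apply: hs2_compl.
  exact: hn_adjoint.
by rewrite hs2_adjoint.
Qed.

Lemma hs2_add A B : (hs2 A < +oo)%E -> (hs2 B < +oo)%E -> (hs2 (A + B)%R < +oo)%E.
Proof.
move=> Af Bf; pose s C := fine (hs2 C).
have sE C : (hs2 C < +oo)%E -> (hs2 C <= (s C)%:E)%E.
  by move=> Cf; rewrite fineK// ge0_fin_numE// esum_ge0// => e _; rewrite lee_fin sqr_ge0.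
move/sE/esum_leP: Af => hA; move/sE/esum_leP: Bf => hB.
apply: (@le_lt_trans _ _ (2 * s A + 2 * s B)%:E); last exact: ltry.
apply/esum_leP => F Ff FE.
apply: (@le_trans _ _ (2 * \sum_(e \in F) hn (A e) ^+ 2 + 2 * \sum_(e \in F) hn (B e) ^+ 2)).
  rewrite !mulr_fsumr -fsbig_split//=; apply: ler_fsum => // e _.
  have := hnD (A e) (B e).
  have := hn_ge0 (A e + B e); have := hn_ge0 (A e); have := hn_ge0 (B e).
  set x := hn (A e); set y := hn (B e); set z := hn _ => y0 x0 z0 zxy.
  have : z ^+ 2 <= (x + y) ^+ 2 by rewrite ler_pXn2r ?nnegrE// addr_ge0.
  by have := sqr_ge0 (x - y); lra.
by have := hA F Ff FE; have := hB F Ff FE; lra.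
Qed.

Lemma hs2_cvg A : (hs2 A < +oo)%E ->
  \sum_(e \in F) hn (A e) ^+ 2 @[F --> finite_subsets (onb H)] --> fine (hs2 A).
Proof. by apply: (@esum_cvg _ _ _ (fun e => hn (A e) ^+ 2)) => e _; exact: sqr_ge0. Qed.

(* Polarization, which reduces the cyclicity of the trace to [hs2_adjoint]. *)
Definition hs_rdot T S : R := (fine (hs2 (T + S)) - fine (hs2 T) - fine (hs2 S)) / 2.

Lemma hs_rdot_cvg T S : (hs2 T < +oo)%E -> (hs2 S < +oo)%E ->
  \sum_(e \in F) rd (T e) (S e) @[F --> finite_subsets (onb H)] --> hs_rdot T S.
Proof.
move=> Tf Sf.
have h : (\sum_(e \in F) hn ((T + S) e) ^+ 2 - \sum_(e \in F) hn (T e) ^+ 2 -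
    \sum_(e \in F) hn (S e) ^+ 2) / 2 @[F --> finite_subsets (onb H)] --> hs_rdot T S.
  apply: cvgM; last exact: cvg_cst.
  by apply: cvgB; [apply: cvgB|]; apply: hs2_cvg => //; exact: hs2_add.
apply: cvg_trans h; apply: near_eq_cvg.
apply: filterS (near_finite_subsets0 _) => F [Ff _].
have -> : \sum_(e \in F) hn ((T + S) e) ^+ 2 = \sum_(e \in F) hn (T e) ^+ 2 +
   \sum_(e \in F) hn (S e) ^+ 2 + 2 * \sum_(e \in F) rd (T e) (S e).
  rewrite mulr_fsumr -!fsbig_split//=; apply: eq_fsbigr => e _.
  rewrite -!rd_hn !rdE (rdC (S e)); lra.
lra.
Qed.

Lemma hs_rdot_adjoint T S : hs_rdot T (adjoint S) = hs_rdot S (adjoint T).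
Proof.
rewrite /hs_rdot !hs2_adjoint -(hs2_adjoint (T + _)) adjointD adjointK.
by rewrite (addrC (adjoint T)) addrAC.
Qed.

Lemma hs2_scale_fin c T : (hs2 T < +oo)%E -> (hs2 (c *: T)%R < +oo)%E.
Proof.
move=> Tf; have cE : c *: T = comp_op (c *: id_op H) T by exact: bop_ext.
have fT : hs2 T = (fine (hs2 T))%:E.
  by rewrite fineK// ge0_fin_numE// esum_ge0// => e _; rewrite lee_fin sqr_ge0.
rewrite cE (le_lt_trans (@hs2_compl T _ (cabs c) (fine (hs2 T)) _ _))//.
- by move=> u; rewrite -[(_ *: id_op H) u]/(c *: u) hnZ.
- by rewrite -fT.
- exact: ltry.
Qed.

Definition has_trace A (l : Cx R) :=
  (fun F : set H => \sum_(e \in F) dot (A e) e) @ finite_subsets (onb H) --> l.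

Lemma has_traceE A l : has_trace A l -> trace A = l.
Proof. by move=> Al; apply: cvg_lim => //; exact: norm_hausdorff. Qed.

Lemma has_traceD A B a b : has_trace A a -> has_trace B b ->
  has_trace (A + B) (a + b).
Proof.
move=> Aa Bb; apply: cvg_trans (cvgD Aa Bb); apply: near_eq_cvg.
apply: filterS (near_finite_subsets0 _) => F [Ff _].
rewrite -[LHS]/(_ + _) -fsbig_split//=; apply: eq_fsbigr => e _.
by rewrite -dotDl.
Qed.

Lemma has_traceZ A c a : has_trace A a -> has_trace (c *: A) (c * a).
Proof.
move=> Aa; apply: cvg_trans (cvgM (cvg_cst c) Aa); apply: near_eq_cvg.
apply: filterS (near_finite_subsets0 _) => F [Ff _].
rewrite -[LHS]/(c * _) mulr_fsumr; apply: eq_fsbigr => e _.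
by rewrite -dotZl.
Qed.

(** Real and imaginary part of the sum of <T e, S^* e>, each by polarization; the adjoint of
    [(ic R)^* *: S] is i S^*, which extracts the imaginary part as in [dotE]. *)
Definition tr_comp S T : Cx R :=
  rc (hs_rdot T (adjoint S)) + ic R * rc (hs_rdot T (adjoint ((ic R)^* *: S))).

Lemma has_trace_comp S T : (hs2 S < +oo)%E -> (hs2 T < +oo)%E ->
  has_trace (comp_op S T) (tr_comp S T).
Proof.
move=> Sf Tf.
have h1 : \sum_(e \in F) rd (T e) (adjoint S e)
    @[F --> finite_subsets (onb H)] --> hs_rdot T (adjoint S).
  by apply: hs_rdot_cvg; rewrite ?hs2_adjoint.
have h2 : \sum_(e \in F) rd (T e) (adjoint ((ic R)^* *: S) e)
    @[F --> finite_subsets (onb H)] --> hs_rdot T (adjoint ((ic R)^* *: S)).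
  by apply: hs_rdot_cvg; rewrite ?hs2_adjoint//; exact: hs2_scale_fin.
apply: cvg_trans (cvgD (rc_cvg h1) (cvgM (cvg_cst (ic R)) (rc_cvg h2))).
apply: near_eq_cvg; apply: filterS (near_finite_subsets0 _) => F [Ff _].
rewrite -[LHS]/(_ + _ * _) !rc_fsum// mulr_fsumr -fsbig_split//=.
apply: eq_fsbigr => e _; rewrite adjointZ conjCK dot_adjoint dotE.
by [].
Qed.

(** [hs_rdot_adjoint] settles the real part; in the imaginary part the factor i must also move from
    [S] to [T], which it does summand by summand. *)
Lemma tr_compC S T : (hs2 S < +oo)%E -> (hs2 T < +oo)%E ->
  tr_comp S T = tr_comp T S.
Proof.
move=> Sf Tf; rewrite /tr_comp hs_rdot_adjoint; congr (_ + _ * rc _).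
rewrite hs_rdot_adjoint.
have h1 : \sum_(e \in F) rd (((ic R)^* *: S) e) (adjoint T e)
    @[F --> finite_subsets (onb H)] --> hs_rdot ((ic R)^* *: S) (adjoint T).
  by apply: hs_rdot_cvg; rewrite ?hs2_adjoint//; exact: hs2_scale_fin.
have h2 : \sum_(e \in F) rd (S e) (adjoint ((ic R)^* *: T) e)
    @[F --> finite_subsets (onb H)] --> hs_rdot S (adjoint ((ic R)^* *: T)).
  by apply: hs_rdot_cvg; rewrite ?hs2_adjoint//; exact: hs2_scale_fin.
have e12 : (fun F => \sum_(e \in F) rd (((ic R)^* *: S) e) (adjoint T e)) =
  (fun F => \sum_(e \in F) rd (S e) (adjoint ((ic R)^* *: T) e)).
  apply/funext => F; apply: eq_fsbigr => e _.
  by rewrite adjointZ conjCK /rd dotZl dotZr.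
rewrite e12 in h1.
by apply: (cvg_unique _ h1 h2); exact: norm_hausdorff.
Qed.

(** Termwise |<T e, S^* e>| <= (|T e|^2 + |S^* e|^2) / 2; the arithmetic mean suffices for a bound
    linear in [s] and [t]. *)
Lemma tr_comp_bound S T (s t : R) : (hs2 S <= s%:E)%E -> (hs2 T <= t%:E)%E ->
  cabs (tr_comp S T) <= (s + t) / 2.
Proof.
move=> Ss Tt; apply: cplx_cvg_bound (has_trace_comp _ _) _.
- exact: le_lt_trans Ss (ltry _).
- exact: le_lt_trans Tt (ltry _).
move: Ss; rewrite -hs2_adjoint => /esum_leP Ss; move/esum_leP: Tt => Tt.
apply: filterS (near_finite_subsets0 _) => F [Ff FE].
rewrite (le_trans (cabs_fsum _ Ff))//.
apply: (@le_trans _ _ ((\sum_(e \in F) hn (T e) ^+ 2 +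
    \sum_(e \in F) hn (adjoint S e) ^+ 2) / 2)); last first.
  by have := Ss F Ff FE; have := Tt F Ff FE; lra.
rewrite -fsbig_split//= mulr_fsuml; apply: ler_fsum => // e _.
rewrite dot_adjoint (le_trans (cauchy_schwarzC _ _))//.
by have := sqr_ge0 (hn (T e) - hn (adjoint S e)); lra.
Qed.

End HilbertSchmidt.

(** * Trace class operators *)

Section TraceClass.
Variables (R : realType) (H : hilbertType R).
Implicit Types (u v w : H) (A B S T D V P Q : bop H) (c : Cx R).

Lemma comp_opA A B D : comp_op A (comp_op B D) = comp_op (comp_op A B) D.
Proof. exact: bop_ext. Qed.

Lemma abs_opP A : positive_op (abs_op A) /\
  comp_op (abs_op A) (abs_op A) = comp_op (adjoint A) A.
Proof.
rewrite /abs_op; apply: (@xgetPex _ 0 [set P : bop H | positive_op P /\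
  comp_op P P = comp_op (adjoint A) A]).
by apply: sqrt_exists => u /=; rewrite dot_adjointl dot_norm exprn_ge0.
Qed.

Lemma hn_abs_op A u : hn (abs_op A u) = hn (A u).
Proof.
have [Pp PP] := abs_opP A; apply/eqP; rewrite -(@eqrXn2 _ 2) ?hn_ge0// -!rd_hn.
by rewrite -(positive_selfadjoint Pp) -[abs_op A (_)]/(comp_op _ _ u) PP /= rd_adjoint adjointK.
Qed.

(** For Q = |A|^(1/2), |A u| = |Q Q u| is the hypothesis of the polar factorization, and <|A| e, e>
    = |Q e|^2 identifies [hs2 Q]. *)
Lemma trace_norm_factor A : exists W Q,
  [/\ A = comp_op W Q, hs2 W = trace_norm A & hs2 Q = trace_norm A].
Proof.
have [Pp _] := abs_opP A.
have [Q [Qp QQ]] := sqrt_exists Pp.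
have [|W AE WQ] := @polar_factorization _ _ A Q Qp.
  by move=> u; rewrite -hn_abs_op -QQ.
have hQ : hs2 Q = trace_norm A.
  rewrite /trace_norm -QQ; apply: eq_esum => e _; congr (_%:E).
  by rewrite -rd_hn -(positive_selfadjoint Qp).
exists W, Q; split=> //; rewrite -hQ; apply: eq_esum => e _.
by rewrite WQ.
Qed.

Lemma trace_norm_ge0 A : (0 <= trace_norm A)%E.
Proof.
have [W [Q [_ <- _]]] := trace_norm_factor A.
by apply: esum_ge0 => e _; rewrite lee_fin sqr_ge0.
Qed.

Lemma trace_norm0 : trace_norm (0 : bop H) = 0%E.
Proof.
have [Pp _] := abs_opP (0 : bop H); rewrite /trace_norm esum1// => e _.
suff -> : abs_op 0 e = 0 by rewrite dot0l.
by apply: hn_eq0; rewrite hn_abs_op hn0.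
Qed.

Lemma trace_class_fin (A : trace_class H) : (trace_norm A < +oo)%E.
Proof. by have /asboolP := trace_classP A. Qed.

Lemma hs2_compr_fin A D : (hs2 A < +oo)%E -> (hs2 (comp_op A D) < +oo)%E.
Proof.
move=> Af; have [M M0 DM] := bop_bounded D.
apply: (le_lt_trans (@hs2_compr _ _ A D M (fine (hs2 A)) (ltW M0) DM _)).
  by rewrite fineK// ge0_fin_numE// esum_ge0// => e _; rewrite lee_fin sqr_ge0.
exact: ltry.
Qed.

Lemma hs2_compl_fin A D : (hs2 A < +oo)%E -> (hs2 (comp_op D A) < +oo)%E.
Proof.
by move=> Af; rewrite -hs2_adjoint adjoint_comp hs2_compr_fin// hs2_adjoint.
Qed.

Lemma has_trace_mulr A D : (trace_norm A < +oo)%E ->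
  has_trace (comp_op A D) (trace (comp_op A D)).
Proof.
move=> Af; have [W [Q [AE hW hQ]]] := trace_norm_factor A.
suff [l h] : exists l, has_trace (comp_op A D) l by rewrite (has_traceE h).
rewrite AE -comp_opA; eexists; apply: has_trace_comp; first by rewrite hW.
by apply: hs2_compr_fin; rewrite hQ.
Qed.

(** In A D = W (Q D) the factors have squared Hilbert-Schmidt norms at most [t] and [M ^+ 2 * t].
    Linearity in [t] for fixed [M] is what gives equicontinuity. *)
Lemma trace_bound A D (t M : R) : (trace_norm A <= t%:E)%E -> 0 <= M ->
  (forall u, hn (D u) <= M * hn u) ->
  cabs (trace (comp_op A D)) <= (1 + M ^+ 2) / 2 * t.
Proof.
move=> At M0 DM; have [W [Q [AE hW hQ]]] := trace_norm_factor A.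
rewrite -hW in At; have Wt := At; rewrite hW -hQ in At.
have QD := hs2_compr M0 DM At.
rewrite {1}AE -comp_opA (has_traceE (has_trace_comp _ _)).
- by apply: (le_trans (tr_comp_bound Wt QD)); lra.
- exact: le_lt_trans Wt (ltry _).
- exact: le_lt_trans QD (ltry _).
Qed.

(** Cyclicity for Hilbert-Schmidt factors: (V W) (Q V' D) is commuted to (Q V' D) (V W), regrouped
    as (Q V' D V) W and commuted back. The trace norm of V A V' is thus never estimated. *)
Lemma has_trace_conj A V V' D : (trace_norm A < +oo)%E ->
  has_trace (comp_op (comp_op (comp_op V A) V') D)
    (trace (comp_op A (comp_op (comp_op V' D) V))).
Proof.
move=> Af; have [W [Q [AE hW hQ]]] := trace_norm_factor A.
rewrite -hW in Af; have Wf := Af; rewrite hW -hQ in Af.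
have -> : comp_op (comp_op (comp_op V A) V') D =
    comp_op (comp_op V W) (comp_op (comp_op Q V') D).
  by rewrite AE; exact: bop_ext.
have -> : comp_op A (comp_op (comp_op V' D) V) =
    comp_op W (comp_op (comp_op (comp_op Q V') D) V).
  by rewrite AE; exact: bop_ext.
have QVDf : (hs2 (comp_op (comp_op Q V') D) < +oo)%E by do 2 apply: hs2_compr_fin.
have VWf : (hs2 (comp_op V W) < +oo)%E by exact: hs2_compl_fin.
rewrite (has_traceE (has_trace_comp Wf (hs2_compr_fin V QVDf))).
rewrite tr_compC//; last exact: hs2_compr_fin.
have <- : tr_comp (comp_op V W) (comp_op (comp_op Q V') D) =
    tr_comp (comp_op (comp_op (comp_op Q V') D) V) W.
  rewrite tr_compC//.
  have h1 := has_traceE (has_trace_comp QVDf VWf).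
  have h2 := has_traceE (has_trace_comp (hs2_compr_fin V QVDf) Wf).
  by rewrite -h1 -h2 comp_opA.
exact: has_trace_comp.
Qed.

Definition rank1_fun w v u : H := dot u v *: w.

Lemma rank1_is_bop w v : rank1_fun w v \in is_bop H.
Proof.
apply: (@bounded_is_bop _ _ _ (hn v * hn w)) => [a x y|u].
  by rewrite /rank1_fun dotDl dotZl scalerDl scalerA.
rewrite hnZ mulrAC (mulrC (hn v)) ler_wpM2r ?hn_ge0//.
exact: cauchy_schwarzC.
Qed.

Definition rank1 w v : bop H := Bop (rank1_is_bop w v).

(** The absolute value [P] vanishes on the orthogonal complement of [v], so <P e, e> is at most a
    constant times |<v, e>|^2, which is summable by Bessel. *)
Lemma trace_norm_rank1 w v : (trace_norm (rank1 w v) < +oo)%E.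
Proof.
have [->|v0] := eqVneq v 0.
  rewrite (_ : rank1 w 0 = 0) ?trace_norm0 ?ltry//.
  by apply: bop_ext => u; rewrite -[LHS]/(dot u 0 *: w) dot0r scale0r.
have vv : dot v v != 0 by rewrite dot_norm expf_neq0// normr_eq0.
have [Pp _] := abs_opP (rank1 w v); set P := abs_op _ in Pp.
have Pker u : dot u v = 0 -> P u = 0.
  move=> uv; apply: hn_eq0; rewrite hn_abs_op -[rank1 w v u]/(dot u v *: w).
  by rewrite uv scale0r hn0.
have PE u : P u = (dot u v / dot v v) *: P v.
  apply/eqP; rewrite -subr_eq0; apply/eqP.
  have <- : P (u - (dot u v / dot v v) *: v) = P u - (dot u v / dot v v) *: P v.
    by rewrite linearB linearZ.
  by apply: Pker; rewrite dotBl dotZl divfK// subrr.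
pose K := cabs (dot v v)^-1 ^+ 2 * cabs (dot (P v) v).
have Pd e : re (dot (P e) e) <= K * cabs (dot v e) ^+ 2.
  have -> : dot (P e) e = (dot e v / dot v v) * (dot (P e) v)^*.
    by rewrite {1}PE dotZl (dot_adjoint P v) (positive_adjoint Pp) -dot_conj.
  rewrite {1}PE dotZl (le_trans (re_le_cabs _))// !(cabsM, cabs_conj).
  by rewrite (dot_conj v e) cabs_conj /K le_eqVlt; apply/orP; left; apply/eqP; ring.
apply: (@le_lt_trans _ _ (K * hn v ^+ 2)%:E); last exact: ltry.
apply/esum_leP => F Ff FE.
apply: (@le_trans _ _ (K * \sum_(e \in F) cabs (dot v e) ^+ 2)).
  by rewrite mulr_fsumr; apply: ler_fsum => // e _; exact: Pd.
rewrite ler_wpM2l ?mulr_ge0 ?sqr_ge0 ?cabs_ge0//.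
by apply: (bessel v (onbP H).1).
Qed.

(** The trace is the sum of <w, e> <e, D^* v>, evaluated by Parseval for [w]. Rank-one operators
    thus read off matrix entries of weak^* limits. *)
Lemma trace_rank1 w v D : trace (comp_op (rank1 w v) D) = dot (D w) v.
Proof.
apply: has_traceE.
have wE : fcomb (dot w) F @[F --> finite_subsets (onb H)] --> w.
  by apply: parseval; exact: onbP.
have h : dot (fcomb (dot w) F) (adjoint D v) @[F --> finite_subsets (onb H)] --> dot w (adjoint D v).
  exact: dot_cvg.
rewrite dot_adjoint; apply: cvg_trans h; apply: near_eq_cvg.
apply: filterS (near_finite_subsets0 _) => F [Ff _].
rewrite dot_fcombl//; apply: eq_fsbigr => e _.
by rewrite -dot_adjoint -[comp_op _ _ e]/(dot (D e) v *: w) dotZl mulrC.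
Qed.

End TraceClass.

Lemma open_trace_norm_ball (R : realType) (H : hilbertType R)
    (A : trace_class H) (r : R) : 0 < r ->
  open (trace_norm_ball (trace_class_op A, r)).
Proof.
move=> r0; exists [set trace_norm_ball (trace_class_op A, r)].
  move=> _ ->; apply: finI_from1; split=> //=; exact: trace_class_fin.
by rewrite bigcup_set1.
Qed.

Lemma tails_filter (T : Type) (le : T -> T -> Prop) :
  directed le -> ProperFilter (tails le).
Proof.
move=> [[t0] lexx le_trans le_dir]; apply: filter_from_proper.
  apply: filter_from_filter; first by exists t0.
  move=> a b _ _; have [c [ac bc]] := le_dir a b.
  by exists c => // d cd; split; [exact: le_trans ac cd|exact: le_trans bc cd].
by move=> a _; exists a; exact: lexx.
Qed.

(** * Convolutions and the convergence argument *)

Section SupImage.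
Variables (R : realType) (T : Type).
Implicit Types (X : set T) (f : T -> R).

(** [0 <= b] covers the empty index set, where [sup] is 0 by convention. *)
Lemma sup_image_itv X f (b : R) : 0 <= b -> (forall t, X t -> 0 <= f t <= b) ->
  0 <= sup [set f t | t in X] <= b.
Proof.
move=> b0 fb; have [->|/set0P[t Xt]] := eqVneq X set0.
  by rewrite image_set0 sup0 lexx.
have ub : ubound [set f t | t in X] b by move=> _ [s Xs <-]; have /andP[] := fb s Xs.
have /andP[f0 _] := fb t Xt; apply/andP; split.
  by apply: (le_trans f0); apply: ub_le_sup; [exists b|exists t].
by apply: ge_sup => //; exists (f t), t.
Qed.

Lemma le_sup_image X f (b : R) t : (forall s, X s -> f s <= b) -> X t ->
  f t <= sup [set f s | s in X].
Proof.
move=> fb Xt; apply: ub_le_sup; last by exists t.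
by exists b => _ [s Xs <-]; exact: fb.
Qed.

End SupImage.

Lemma family_cvg0P (R : realType) (I : Type) (Xi : topologicalType)
    (F : set_system I) {FF : Filter F} (f : I -> Xi -> R) :
  {family compact, f @ F --> (fun _ : Xi => 0 : R)} <->
  forall C : set Xi, compact C -> forall e : R, 0 < e ->
    \forall i \near F, forall y, C y -> `|f i y| < e.
Proof.
split=> [/fam_cvgP fF C Cc e e0|fF].
  have /fF : compact C by [].
  move=> /(_ [set h | forall y, C y -> `|h y| < e]); apply.
  apply/uniform_nbhs; exists [set xy | ball xy.1 e xy.2]; split.
    exact: (entourage_ball R (PosNum e0)).
  by move=> h /= hC y /hC; rewrite -ball_normE /= sub0r normrN.
apply/fam_cvgP => C Cc A /uniform_nbhs[E [Eent EA]].
move: Eent; rewrite -entourage_from_ballE => -[e /= e0 eE].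
have := fF C Cc e e0; apply: filterS => i fi; apply: EA => /= y Cy.
by apply: eE; rewrite /= -ball_normE /= sub0r normrN fi.
Qed.

(** * Convolutions: norm bound, translation covariance, boundary limits *)

Section Convolution.
Variables (R : realType) (Xi : topologicalZmodType) (H : hilbertType R).
Variables (m : Xi -> Xi -> Cx R) (U : Xi -> bop H) (P : bop H).
Hypothesis m1 : forall x y, `|m x y| = 1.
Hypothesis Uunit : forall x, unitary_op (U x).
Hypothesis UM : forall x y, comp_op (U x) (U y) = m x y *: U (x + y).
Hypothesis Punit : unitary_op P.
Implicit Types (A B D : bop H) (x y w : Xi).

Lemma hn_alpha y D (M : R) : (forall u, hn (D u) <= M * hn u) ->
  forall u, hn (alpha U y D u) <= M * hn u.
Proof.
move=> DM u; rewrite -[alpha U y D u]/(U y (D (adjoint (U y) u))).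
by rewrite hn_unitary// (le_trans (DM _))// hn_unitary_adjoint.
Qed.

Lemma hn_beta_minus D (M : R) : (forall u, hn (D u) <= M * hn u) ->
  forall u, hn (beta_minus P D u) <= M * hn u.
Proof.
move=> DM u; rewrite -[beta_minus P D u]/(P (D (P u))).
by rewrite hn_unitary// (le_trans (DM _))// hn_unitary.
Qed.

Lemma conv_bound A D y (t M : R) : (trace_norm A <= t%:E)%E -> 0 <= M ->
  (forall u, hn (D u) <= M * hn u) ->
  cabs (Defs.conv U P A D y) <= (1 + M ^+ 2) / 2 * t.
Proof.
move=> At M0 DM; apply: trace_bound => //.
by apply: hn_alpha; exact: hn_beta_minus.
Qed.

(** Since U_w U_(y-w) = m(w, y - w) U_y, the product U_w^* U_y is U_(y-w) up to a phase; the
    right-hand factor carries the conjugate phase, and the two cancel by unimodularity. *)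
Lemma alpha_shift w y D :
  comp_op (comp_op (adjoint (U w)) (alpha U y D)) (U w) = alpha U (y - w) D.
Proof.
have KE : comp_op (adjoint (U w)) (U y) = (m w (y - w))^-1 *: U (y - w).
  apply: bop_ext => u.
  have h : m w (y - w) *: U y u = U w (U (y - w) u).
    by rewrite -[RHS]/(comp_op (U w) (U (y - w)) u) UM (addrC w) subrK.
  rewrite -[LHS]/(adjoint (U w) (U y u)) -[RHS]/(_ *: U (y - w) u).
  rewrite -[in RHS]((Uunit w).1 (U (y - w) u)) -h.
  by rewrite linearZ /= scalerA mulVf ?scale1r// -normr_eq0 m1 oner_eq0.
have KE' : comp_op (adjoint (U y)) (U w) =
    ((m w (y - w))^-1)^* *: adjoint (U (y - w)).
  by rewrite -adjointZ -KE adjoint_comp adjointK.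
apply: bop_ext => u.
rewrite -[LHS]/(comp_op (adjoint (U w)) (U y) (D (comp_op (adjoint (U y)) (U w) u))).
rewrite KE KE' -[LHS]/(_ *: U (y - w) (D (_ *: adjoint (U (y - w)) u))).
rewrite -[RHS]/(U (y - w) (D (adjoint (U (y - w)) u))).
rewrite !linearZ /= scalerA mulrC -normCK normfV m1 invr1 expr1n.
by rewrite scale1r.
Qed.

Lemma has_trace_alpha A D w y : (trace_norm A < +oo)%E ->
  has_trace (comp_op (alpha U w A) (alpha U y (beta_minus P D)))
    (Defs.conv U P A D (y - w)).
Proof.
move=> Af; rewrite /Defs.conv -alpha_shift; exact: has_trace_conj.
Qed.

(** Pairing a limit [C] with the rank-one operator of [w] and [C w] exhibits |C w|^2 as a limit of
    <alpha_y(B) w, C w>, each of modulus at most M |w| |C w|. *)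
Lemma alpha_bd_bounded (F : set_system Xi) {FF : ProperFilter F}
    (x : sigmaXi R Xi) B (M : R) : 0 <= M ->
  (forall u, hn (B u) <= M * hn u) -> (fun y => point_eval R y) @ F --> x ->
  forall u, hn (alpha_bd U x B u) <= M * hn u.
Proof.
move=> M0 BM Fx w; rewrite /alpha_bd.
(* In the second case [xget] returns its default 0, for which the bound is immediate from
   [0 <= M]. *)
case: xgetP => [C _ /= CP|_]; last first.
  by rewrite -[(0 : bop H) w]/(0 : H) hn0 mulr_ge0 ?hn_ge0.
have [->|h0] := eqVneq (hn (C w)) 0; first by rewrite mulr_ge0 ?hn_ge0.
have hp : 0 < hn (C w) by rewrite lt_neqAle eq_sym h0 hn_ge0.
have Af : `[< (trace_norm (rank1 w (C w)) < +oo)%E >].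
  by apply/asboolP; exact: trace_norm_rank1.
have := CP F FF Fx (TraceClass Af); rewrite /= trace_rank1 => h.
have := cplx_cvg_bound (M := M * hn w * hn (C w)) h.
rewrite dot_norm hnormE -rcX cabs_rc ger0_norm ?sqr_ge0// expr2 ler_pM2r//; apply.
apply: nearW => y; rewrite trace_rank1 (le_trans (cauchy_schwarzC _ _))//.
by rewrite ler_wpM2r ?hn_ge0// hn_alpha.
Qed.

End Convolution.

Theorem theorem4p6 (R : realType) (Xi : topologicalZmodType)
    (m : Xi -> Xi -> Cx R) (Hm : phase_space m)
    (mu : {measure set (borel Xi) -> \bar R}) (Hmu : haar_measure mu)
    (H : hilbertType R) (U : Xi -> bop H)
    (HU : projective_rep m U) (Uirr : irreducible_rep U)
    (Uint : integrable_rep mu U)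
    (P : bop H) (HP : parity_op U P)
    (S : set (trace_class H)) (Sreg : regular_set U S)
    (K : set (trace_class H)) (Kprecompact : precompact K)
    (X : set (bop H)) (Xbounded : bounded_ops X)
    (x : sigmaXi R Xi) (xboundary : boundary x)
    (Gamma : Type) (le : Gamma -> Gamma -> Prop) (Hle : directed le)
    (z : Gamma -> Xi)
    (zx : (fun gamma => point_eval R (z gamma)) @ tails le --> x) :
  (forall A0 : trace_class H, S A0 ->
    {family compact,
      (fun gamma => sup_defect U P X x (z gamma) A0) @ tails le
        --> (fun _ : Xi => 0 : R)}) ->
  {family compact,
    (fun gamma y => sup [set sup_defect U P X x (z gamma) A y | A in K])
      @ tails le --> (fun _ : Xi => 0 : R)}.
Proof.
move=> HS.
have tF := tails_filter Hle.
have m1 := phase_unimodular Hm.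
have Uu := rep_unitary HU.
have UM := rep_mul HU.
have [_ Pu _] := HP.
have [M M0 XM] : exists2 M : R, 0 <= M & forall B, X B -> forall u, hn (B u) <= M * hn u.
  (* The given bound is a complex number; as [M * |u|] dominates a norm, it is nonnegative and
     equals its own modulus. *)
  have [M XM] := Xbounded; exists (cabs M) => [|B XB u]; first exact: cabs_ge0.
  have h := XM B XB u.
  have h0 : 0 <= M * `|u| by exact: le_trans (normr_ge0 _) h.
  rewrite -ler_rc rcM -!hnormE -normr_cabs (le_trans h)//.
  by rewrite -[X in _ <= _ * X]normr_id -normrM ger0_norm.
pose D gamma B : bop H := alpha U (z gamma) B - alpha_bd U x B.
pose N := M + M.
have N0 : 0 <= N by rewrite addr_ge0.
have DN gamma B : X B -> forall u, hn (D gamma B u) <= N * hn u.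
  move=> XB u; rewrite -[D gamma B u]/(alpha U (z gamma) B u - alpha_bd U x B u).
  rewrite (le_trans (hnD _ _))// hnN mulrDl lerD//.
    by apply: hn_alpha => //; exact: XM.
  (* [alpha_bd] is tested on filters on the group, so the net enters through the image of its tail
     filter. *)
  exact: (alpha_bd_bounded (F := z @ tails le) Uu M0 (XM B XB) zx).
pose c0 := (1 + N ^+ 2) / 2.
have c00 : 0 < c0 by rewrite divr_gt0// ltr_pwDl// sqr_ge0.
have tnE (A : bop H) : (trace_norm A < +oo)%E -> (trace_norm A <= (fine (trace_norm A))%:E)%E.
  by move=> Af; rewrite fineK// ge0_fin_numE// trace_norm_ge0.
have conv_le (A : bop H) gamma B y t : X B -> (trace_norm A <= t%:E)%E ->
    cabs (Defs.conv U P A (D gamma B) y) <= c0 * t.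
  by move=> XB At; apply: conv_bound => //; exact: DN.
(* [has_trace] is recorded because [trace] is only additive where it converges. *)
pose good (A : bop H) :=
  (forall gamma B y, has_trace (comp_op A (alpha U y (beta_minus P (D gamma B))))
     (Defs.conv U P A (D gamma B) y)) /\
  forall C : set Xi, compact C -> forall e : R, 0 < e ->
    \forall gamma \near tails le, forall y, C y -> forall B, X B ->
      cabs (Defs.conv U P A (D gamma B) y) < e.
have good0 : good 0.
  have h0 : (trace_norm (0%R : bop H) <= 0%:E)%E by rewrite trace_norm0.
  split=> [gamma B y|C Cc e e0].
    by apply: has_trace_mulr; rewrite trace_norm0 ltry.
  apply: nearW => gamma y _ B XB.
  by rewrite (le_lt_trans (conv_le _ _ _ _ _ XB h0))// mulr0.
have goodD A B : good A -> good B -> good (A + B).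
  move=> [At Ag] [Bt Bg].
  have h gamma E y := has_traceD (At gamma E y) (Bt gamma E y).
  have addE T : comp_op A T + comp_op B T = comp_op (A + B) T by exact: bop_ext.
  have cE gamma E y : Defs.conv U P (A + B) (D gamma E) y =
      Defs.conv U P A (D gamma E) y + Defs.conv U P B (D gamma E) y.
    by rewrite {1}/Defs.conv -addE (has_traceE (h _ _ _)).
  split=> [gamma E y|C Cc e e0]; first by rewrite cE -addE; exact: h.
  have e2 : 0 < e / 2 by rewrite divr_gt0.
  apply: filterS2 (Ag C Cc _ e2) (Bg C Cc _ e2) => gamma h1 h2 y Cy E XE.
  rewrite cE (le_lt_trans (cabsD _ _))//.
  by have := h1 y Cy E XE; have := h2 y Cy E XE; lra.
have goodZ c A : good A -> good (c *: A).
  move=> [At Ag]; have h gamma E y := has_traceZ (c := c) (At gamma E y).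
  have scE T : c *: comp_op A T = comp_op (c *: A) T by exact: bop_ext.
  have cE gamma E y : Defs.conv U P (c *: A) (D gamma E) y =
      c * Defs.conv U P A (D gamma E) y.
    by rewrite {1}/Defs.conv -scE (has_traceE (h _ _ _)).
  split=> [gamma E y|C Cc e e0]; first by rewrite cE -scE; exact: h.
  have c1 : 0 < cabs c + 1 by rewrite ltr_wpDl ?cabs_ge0.
  have := Ag C Cc _ (divr_gt0 e0 c1); apply: filterS => gamma h1 y Cy E XE.
  have := h1 y Cy E XE; rewrite ltr_pdivlMr// => h2.
  rewrite cE cabsM (le_lt_trans _ h2)// mulrC ler_wpM2l ?cabs_ge0// lerDl.
  exact: ler01.
have goodS (A : trace_class H) w : S A -> good (alpha U w A).
  move=> SA; have Af := trace_class_fin A.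
  have h gamma B y : has_trace (comp_op (alpha U w A)
      (alpha U y (beta_minus P (D gamma B)))) (Defs.conv U P A (D gamma B) (y - w)).
    exact: (has_trace_alpha m1).
  have cE gamma B y : Defs.conv U P (alpha U w A) (D gamma B) y =
      Defs.conv U P A (D gamma B) (y - w) by exact: has_traceE.
  split=> [gamma B y|C Cc e e0]; first by rewrite cE; exact: h.
  (* The defect of [alpha U w A] at [y] is that of [A] at [y - w], so the hypothesis on [A] is used
     on the compact translate C - w. *)
  have Cw : compact [set y - w | y in C].
    apply: continuous_compact => //; apply: continuous_subspaceT => y.
    apply: (@continuous2_cvg Xi Xi Xi Xi (nbhs y) _ id (cst w) (fun a b => a - b) y w).
    - exact: (@sub_continuous Xi (y, w)).
    - exact: cvg_id.
    - exact: cvg_cst.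
  have /family_cvg0P/(_ _ Cw _ e0) := HS A SA; apply: filterS => gamma hg y Cy B XB.
  rewrite cE; have Cyw : [set y - w | y in C] (y - w) by exists y.
  apply: le_lt_trans (hg _ Cyw); apply: le_trans (ler_norm _).
  (* The real [sup] dominates its members only for sets bounded above; [conv_le] supplies the
     bound. *)
  apply: (le_sup_image (f := fun B => cabs (Defs.conv U P A (D gamma B) (y - w)))
     (b := c0 * fine (trace_norm A))) => // E XE.
  by apply: conv_le => //; exact: tnE.
have goodspan (A : bop H) : lin_span [set B : bop H | exists (A0 : trace_class H) (x : Xi),
       S A0 /\ B = alpha U x A0] A -> good A.
  move=> [n [c [a [aS ->]]]]; elim/big_ind: _ => // i _; apply: goodZ.
  by have [A0 [w [SA0 ->]]] := aS i; exact: goodS.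
apply/family_cvg0P => C Cc e e0.
(* Three errors of size [e / 4] arise: from [A] to a span element [A'], from [A] to a nearby [B],
   and the defect at [A']. Their sum [3 / 4 * e] stays strictly below [e] after the suprema are
   taken. *)
pose d := e / 4 / c0.
have d0 : 0 < d by apply: divr_gt0 => //; exact: divr_gt0.
have c0d : c0 * d = e / 4 by rewrite /d mulrC divfK// gt_eqF.
have Kc : compact (closure K) by rewrite -precompactE.
pose small gamma (A : trace_class H) := forall y, C y -> forall B, X B ->
  cabs (Defs.conv U P A (D gamma B) y) <= 3 / 4 * e.
have near_small : \forall gamma \near tails le, closure K `<=` small gamma.
  (* Compactness as near-covering: for each [A] it suffices to find a neighbourhood and a set of the
     tail filter that work jointly. *)
  apply: ((compact_near_coveringP _).1 Kc) => A _.
  have Ao := open_trace_norm_ball A d0.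
  have AA : trace_norm_ball (trace_class_op A, d) A.
    by rewrite /trace_norm_ball /= subrr trace_norm0 lte_fin.
  (* By regularity the nonempty open ball around [A] meets the span of the translates of [S], where
     [good] holds. *)
  have [A' [AA' A'span]] := Sreg _ (ex_intro _ A AA) Ao.
  have [_ /(_ C Cc (e / 4))] := goodspan _ A'span.
  rewrite divr_gt0// => /(_ isT) A'small.
  exists (trace_norm_ball (trace_class_op A, d),
    [set gamma | forall y, C y -> forall B, X B ->
      cabs (Defs.conv U P A' (D gamma B) y) < e / 4]).
    by split=> //=; apply: open_nbhs_nbhs.
  move=> [B gamma] /= [AB gammaA'] y Cy E XE.
  have close (Z : trace_class H) : trace_norm_ball (trace_class_op A, d) Z ->
      cabs (Defs.conv U P A (D gamma E) y - Defs.conv U P Z (D gamma E) y) <= e / 4.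
    move=> /ltW AZ; rewrite -c0d; set T := alpha U y (beta_minus P (D gamma E)).
    have tA : has_trace (comp_op A T) (Defs.conv U P A (D gamma E) y).
      exact: (has_trace_mulr (trace_class_fin A)).
    have tZ : has_trace (comp_op Z T) (Defs.conv U P Z (D gamma E) y).
      exact: (has_trace_mulr (trace_class_fin Z)).
    have subE : comp_op A T + -1 *: comp_op Z T =
        comp_op (trace_class_op A - trace_class_op Z) T.
      by rewrite scaleN1r; exact: bop_ext.
    have := has_traceD tA (has_traceZ (c := -1) tZ); rewrite mulN1r subE.
    move=> /has_traceE trE.
    have := conv_le (trace_class_op A - trace_class_op Z) gamma E y d XE AZ.
    by rewrite {1}/Defs.conv -/T trE.
  have h1 := close _ AA'; have h2 := close _ AB; have h3 := gammaA' y Cy E XE.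
  by apply: (le_trans (cabs_near h1 h2 (ltW h3))); lra.
apply: filterS near_small => gamma Ksmall y Cy.
rewrite (@le_lt_trans _ _ (3 / 4 * e))//; last by lra.
have e34 : 0 <= 3 / 4 * e by lra.
suff /andP[h1 h2] : 0 <= sup [set sup_defect U P X x (z gamma) A y | A in K] <= 3 / 4 * e.
  by rewrite ger0_norm.
apply: sup_image_itv => // A KA; apply: sup_image_itv => // B XB.
by rewrite cabs_ge0 Ksmall//; exact: subset_closure.
Qed.
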